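(* Let $d\ge 2$, $B\in[2,\infty)$ and $\alpha\in(0,1)$. For any $0<\beta<1-\alpha$, there are constants $N=N(\alpha,\beta)$ (which may also depend on $B,d$) and $c>0$ (depending only on $B$ and $d$) such that the following holds: if $\min(n_1,n_2)\ge N$, then for any level-$\alpha$ test $\varphi$ there exist distributions $(P,Q)\in\mathcal{P}^\infty(d)$ satisfying $$d_{\mathrm{BV}}(P,Q)\ \ge\ c\left(\frac{\log\min(n_1,n_2)}{\min(n_1,n_2)}\right)^{1/d},$$ but for which $\mathbb{E}_{P,Q}[\varphi]\le 1-\beta$.
   Context: Samples: $X_1,\dots,X_{n_1}$ i.i.d. from $P$ and $Y_1,\dots,Y_{n_2}$ i.i.d. from $Q$, all independent, $n=n_1+n_2$; $\mathbb{E}_{P,Q}$ denotes expectation under this model. Class of distributions: $\mathcal{P}^\infty(d)=\mathcal{P}^\infty(d,B)$ is the set of pairs $(P,Q)$ of probability distributions such that (A1) both are supported on $\Omega=(0,1)^d$; (A2) both are absolutely continuous with respect to Lebesgue measure, with densities $p,q$; (A3) with $\mu:=\frac{n_1}{n}p+\frac{n_2}{n}q$, one has $|p(x)-q(x)|\le B$ and $\frac1B\le\mu(x)\le B$ for all $x\in\Omega$. A test is a measurable $\{0,1\}$-valued function $\varphi$ of the two samples. It is level-$\alpha$ (for the null hypothesis $P=Q$) if $\mathbb{E}_{P,P}[\varphi]\le\alpha$ for every $P$ with $(P,P)\in\mathcal{P}^\infty(d)$. Total variation: for $f\in L^1(\mathbb{R}^d)$, $\mathrm{TV}(f)=\sup\{\int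 f\,\mathrm{div}\,\phi:\ \phi\in C_c^1(\mathbb{R}^d;\mathbb{R}^d),\ \|\phi(x)\|_2\le 1\ \forall x\}$. TV IPM: $d_{\mathrm{BV}}(P,Q)=\sup_{f:\mathrm{TV}(f)\le 1}\mathbb{E}_P[f(X)]-\mathbb{E}_Q[f(Y)]$. *)

(* Defs.v *)
From HB Require Import structures.
From mathcomp Require Import all_boot all_order all_algebra.
From mathcomp Require Import all_classical all_reals all_analysis.
Set Implicit Arguments.
Unset Strict Implicit.
Unset Printing Implicit Defensive.
Import Order.TTheory GRing.Theory Num.Theory.
Import numFieldNormedType.Exports.
Local Open Scope classical_set_scope.
Local Open Scope ring_scope.

(* The space R^d is ['rV[R]_d], with the product sigma-algebra generated by the
   coordinates (the Borel sigma-algebra when [T] is the real line). *)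

Definition measure_rV_display : measure_display -> measure_display.
Proof. exact. Qed.

Section measurable_rV.
Context {disp : measure_display} {T : sigmaRingType disp}.
Variable d : nat.

Let coors : 'I_d -> 'rV[T]_d -> T := fun i x => x ord0 i.

Let rV_set0 : g_sigma_preimage coors set0.
Proof. exact: sigma_algebra0. Qed.

Let rV_setC A : g_sigma_preimage coors A -> g_sigma_preimage coors (~` A).
Proof. exact: sigma_algebraC. Qed.

Let rV_bigcup (F : _^nat) : (forall i, g_sigma_preimage coors (F i)) ->
  g_sigma_preimage coors (\bigcup_i (F i)).
Proof. exact: sigma_algebra_bigcup. Qed.

HB.instance Definition _ := @isMeasurable.Build (measure_rV_display disp)
  'rV[T]_d (g_sigma_preimage coors) rV_set0 rV_setC rV_bigcup.

End measurable_rV.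


Lemma measurable_coord_rV (disp : measure_display) (T : sigmaRingType disp)
    (d : nat) (i : 'I_d) :
  measurable_fun [set: 'rV[T]_d] (fun x : 'rV[T]_d => x ord0 i).
Proof.
move=> _ Y mY; rewrite setTI; apply: sub_sigma_algebra => /=.
rewrite -bigcup_seq/=; exists i => /=; first by rewrite mem_index_enum.
by exists Y => //; rewrite setTI.
Qed.

Lemma measurable_fun_rV (d1 d2 : measure_display) (T1 : measurableType d1)
    (T2 : measurableType d2) (d : nat) (f : T1 -> 'rV[T2]_d) :
  (forall i, measurable_fun setT (fun x => f x ord0 i)) ->
  measurable_fun setT f.
Proof.
move=> mf.
pose coors (i : 'I_d) (x : 'rV[T2]_d) := x ord0 i.
apply: (@measurability _ _ _ _ _ _
  (\big[setU/set0]_(i < d) preimage_set_system setT (coors i) measurable)) => //.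
move=> _ [A + <-].
rewrite -bigcup_seq/= => -[i _ [Y mY <-]].
by rewrite setTI; exact: mf.
Qed.

Definition row_of_tuple (T : Type) (d : nat) (t : d.-tuple T) : 'rV[T]_d :=
  \row_(i < d) tnth t i.

Lemma measurable_row_of_tuple (disp : measure_display)
    (T : measurableType disp) (d : nat) :
  measurable_fun [set: d.-tuple T] (@row_of_tuple T d).
Proof.
apply: measurable_fun_rV => i.
rewrite (_ : (fun _ => _) = (fun t : d.-tuple T => tnth t i)).
  exact: measurable_tnth.
by apply/funext => t; rewrite mxE.
Qed.

Lemma sigma_finite_product_measure (d1 d2 : measure_display)
    (T1 : measurableType d1) (T2 : measurableType d2) (R : realType)
    (m1 : {sigma_finite_measure set T1 -> \bar R})
    (m2 : {sigma_finite_measure set T2 -> \bar R}) :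
  sigma_finite setT (m1 \x m2)%E.
Proof.
have /sigma_finiteP[F [TF ndF Foo]] := sigma_finiteT m1.
have /sigma_finiteP[G [TG ndG Goo]] := sigma_finiteT m2.
exists (fun n => F n `*` G n).
  rewrite -setXTT TF TG predeqE => -[x y]; split.
    move=> [/= [n _ Fnx] [k _ Gky]]; exists (maxn n k) => //; split.
    - by move: x Fnx; exact/subsetPset/ndF/leq_maxl.
    - by move: y Gky; exact/subsetPset/ndG/leq_maxr.
  by move=> [n _ []/= ? ?]; split; exists n.
move=> k; have [? ?] := Foo k; have [? ?] := Goo k.
split; first exact: measurableX.
by rewrite product_measure1E// lte_mul_pinfty// ge0_fin_numE.
Qed.

Section cons_measure.
Context {disp : measure_display} {T : measurableType disp} {R : realType}.
Variables (mu : {sigma_finite_measure set T -> \bar R}) (n : nat).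
Variable nu : {sigma_finite_measure set (n.-tuple T) -> \bar R}.

Definition cons_pair (p : T * n.-tuple T) : n.+1.-tuple T :=
  [tuple of p.1 :: p.2].

Lemma measurable_cons_pair : measurable_fun setT cons_pair.
Proof. exact: measurable_cons. Qed.

Definition cons_measure : set (n.+1.-tuple T) -> \bar R :=
  pushforward (mu \x nu)%E cons_pair.

Let cons_measure0 : cons_measure set0 = 0%E.
Proof. by rewrite /cons_measure measure0//; exact: measurable_cons_pair. Qed.

Let cons_measure_ge0 A : (0 <= cons_measure A)%E.
Proof. by apply: measure_ge0; exact: measurable_cons_pair. Qed.

Let cons_measure_sigma_additive : semi_sigma_additive cons_measure.
Proof.
by apply: measure_semi_sigma_additive; exact: measurable_cons_pair.
Qed.

HB.instance Definition _ := isMeasure.Build _ _ _ cons_measure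
  cons_measure0 cons_measure_ge0 cons_measure_sigma_additive.

Let cons_measure_sigma_finite : sigma_finite setT cons_measure.
Proof.
have [F FT Foo] := sigma_finite_product_measure mu nu.
pose uncons (t : n.+1.-tuple T) := (thead t, [tuple of behead t]).
have consK : cancel cons_pair uncons.
  by move=> [x t]; congr pair; apply/val_inj.
have unconsK : cancel uncons cons_pair.
  by move=> t; rewrite /cons_pair/= [RHS]tuple_eta; apply/val_inj.
have muncons : measurable_fun setT uncons.
  apply/measurable_fun_pairP; split; first exact: measurable_tnth.
  exact: measurable_behead.
exists (fun k => uncons @^-1` F k); first by rewrite -preimage_bigcup -FT.
move=> k; have [mF oo] := Foo k; split.
  by rewrite -[X in measurable X]setTI; exact: muncons.
rewrite /cons_measure /pushforward (_ : _ @^-1` _ = F k)//.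
by apply/seteqP; split => x /=; rewrite consK.
Qed.

HB.instance Definition _ := Measure_isSigmaFinite.Build _ _ _ cons_measure
  cons_measure_sigma_finite.

End cons_measure.

Section power_measure.
Context {disp : measure_display} {T : measurableType disp} {R : realType}.

Fixpoint power_measure_rec (mu : {sigma_finite_measure set T -> \bar R})
    (n : nat) : {sigma_finite_measure set (n.-tuple T) -> \bar R} :=
  match n with
  | 0 => dirac ([tuple] : 0.-tuple T)
  | n.+1 => cons_measure mu (power_measure_rec mu n)
  end.

(* the [n]-fold product measure [mu \x ... \x mu] on [n.-tuple T] *)
Definition power_measure (mu : {sigma_finite_measure set T -> \bar R})
  (n : nat) : set (n.-tuple T) -> \bar R := power_measure_rec mu n.
Arguments power_measure mu n : clear implicits.

HB.instance Definition _ mu n := SigmaFiniteMeasure.copy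
  (power_measure mu n) (power_measure_rec mu n).

Lemma power_measure_setT (P : probability T R) (n : nat) :
  power_measure P n setT = 1%E.
Proof.
elim: n => [|n IH]; first by rewrite /power_measure/= diracT.
rewrite /power_measure/= /cons_measure /pushforward preimage_setT.
rewrite -setXTT product_measure1E// [X in (X * _)%E]probability_setT mul1e.
exact: IH.
Qed.

HB.instance Definition _ (P : probability T R) n :=
  Measure_isProbability.Build _ _ _ (power_measure P n)
    (power_measure_setT P n).

Lemma power_measure_box (mu : {sigma_finite_measure set T -> \bar R}) (n : nat)
    (A : 'I_n -> set T) : (forall i, measurable (A i)) ->
  (power_measure mu n [set t | forall i, A i (tnth t i)] =
   \prod_(i < n) mu (A i))%E.
Proof.
elim: n A => [|n IH] A mA.
  rewrite big_ord0 /power_measure/= diracE mem_set//= => -[]//.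
rewrite big_ord_recl /power_measure/= /cons_measure /pushforward.
rewrite (_ : _ @^-1` _ =
  A ord0 `*` [set t | forall i, A (lift ord0 i) (tnth t i)]).
  rewrite product_measure1E//.
    by congr (_ * _)%E; exact: IH.
  rewrite (_ : [set t | _] = \bigcap_(i in [set: 'I_n])
      (fun t : n.-tuple T => tnth t i) @^-1` A (lift ord0 i)).
    apply: fin_bigcap_measurable; first exact: finite_finset.
    by move=> i _; rewrite -[X in measurable X]setTI; exact: measurable_tnth.
  by apply/seteqP; split => t /= h i; [move=> _; exact: h|exact: (h i I)].
apply/seteqP; split => -[x t] /=.
  move=> h; split; first exact: (h ord0).
  by move=> i; have := h (lift ord0 i); rewrite tnthS.
move=> [h0 h] i; have [j ->|->] := unliftP ord0 i; last exact: h0.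
by rewrite tnthS.
Qed.

End power_measure.
Arguments power_measure {disp T R} mu n _.

Section lebesgue_measure_rV.
Context {R : realType} {d : nat}.

Definition lebesgue_rV : set 'rV[R]_d -> \bar R :=
  pushforward (power_measure lebesgue_measure d) (@row_of_tuple R d).

Let lebesgue_rV0 : lebesgue_rV set0 = 0%E.
Proof. by rewrite /lebesgue_rV measure0//; exact: measurable_row_of_tuple. Qed.

Let lebesgue_rV_ge0 A : (0 <= lebesgue_rV A)%E.
Proof. by apply: measure_ge0; exact: measurable_row_of_tuple. Qed.

Let lebesgue_rV_sigma_additive : semi_sigma_additive lebesgue_rV.
Proof.
by apply: measure_semi_sigma_additive; exact: measurable_row_of_tuple.
Qed.

HB.instance Definition _ := isMeasure.Build _ _ _ lebesgue_rV
  lebesgue_rV0 lebesgue_rV_ge0 lebesgue_rV_sigma_additive.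

Let lebesgue_rV_sigma_finite : sigma_finite setT lebesgue_rV.
Proof.
have [F FT Foo] := sigma_finiteT (power_measure (@lebesgue_measure R) d).
pose tuple_of_row (x : 'rV[R]_d) := [tuple x ord0 i | i < d].
have rowK : cancel (@row_of_tuple R d) tuple_of_row.
  by move=> t; apply: eq_from_tnth => i; rewrite tnth_mktuple mxE.
have mtuple : measurable_fun setT tuple_of_row.
  apply/measurable_fun_tnthP => i.
  rewrite (_ : _ \o _ = fun x : 'rV[R]_d => x ord0 i).
    exact: measurable_coord_rV.
  by apply/funext => x /=; rewrite tnth_mktuple.
exists (fun k => tuple_of_row @^-1` F k); first by rewrite -preimage_bigcup -FT.
move=> k; have [mF oo] := Foo k; split.
  by rewrite -[X in measurable X]setTI; exact: mtuple.
rewrite /lebesgue_rV /pushforward (_ : _ @^-1` _ = F k)//.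
by apply/seteqP; split => x /=; rewrite rowK.
Qed.

HB.instance Definition _ := Measure_isSigmaFinite.Build _ _ _ lebesgue_rV
  lebesgue_rV_sigma_finite.

Lemma lebesgue_rV_box (A : 'I_d -> set R) : (forall i, measurable (A i)) ->
  (lebesgue_rV [set x | forall i, A i (x ord0 i)] =
   \prod_(i < d) lebesgue_measure (A i))%E.
Proof.
move=> mA; rewrite -power_measure_box//.
rewrite /lebesgue_rV /pushforward; congr (power_measure _ _ _).
by apply/seteqP; split => t /= h i; have := h i; rewrite mxE.
Qed.

End lebesgue_measure_rV.

Section distributions.
Context {R : realType} {d : nat}.

Definition unit_cube : set 'rV[R]_d := [set x | forall i, 0 < x ord0 i < 1].

Definition is_density (P : probability 'rV[R]_d R) (p : 'rV[R]_d -> R) :=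
  [/\ measurable_fun setT p, forall x, 0 <= p x &
      forall A, measurable A -> P A = (\int[lebesgue_rV]_(x in A) (p x)%:E)%E].

(* Densities being defined up to null sets, the pointwise bounds are required
   of some choice of the densities. *)
Definition in_Pinfty (B : R) (n1 n2 : nat) (P Q : probability 'rV[R]_d R) :=
  [/\ P unit_cube = 1%E /\ Q unit_cube = 1%E,
      P `<< lebesgue_rV /\ Q `<< lebesgue_rV &
      exists p q : 'rV[R]_d -> R, [/\ is_density P p, is_density Q q &
        forall x, unit_cube x ->
          let mu := n1%:R / (n1 + n2)%:R * p x + n2%:R / (n1 + n2)%:R * q x in
          `|p x - q x| <= B /\ B^-1 <= mu <= B]].

End distributions.

Section total_variation.
Context {R : realType} {d : nat}.

(* [`|x|] is the sup norm on matrices *)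
Definition norm2 (x : 'rV[R]_d) : R := Num.sqrt (\sum_(i < d) x ord0 i ^+ 2).

Definition divergence (phi : 'rV[R]_d -> 'rV[R]_d) (x : 'rV[R]_d) : R :=
  \sum_(i < d) 'D_(delta_mx ord0 i) (fun y => phi y ord0 i) x.

Definition C1_compact_support (phi : 'rV[R]_d -> 'rV[R]_d) :=
  [/\ forall x, differentiable phi x,
      continuous (jacobian phi) &
      compact (closure [set x | phi x != 0])].

Definition TV (f : 'rV[R]_d -> R) : \bar R :=
  ereal_sup [set (\int[lebesgue_rV]_x (f x * divergence phi x)%:E)%E | phi in
    [set phi | C1_compact_support phi /\ forall x, norm2 (phi x) <= 1]].

(* [TV] being defined on L^1(R^d), so is the class of test functions. When [P]
   and [Q] have bounded densities, both expectations below are finite. *)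
Definition d_BV (P Q : probability 'rV[R]_d R) : \bar R :=
  ereal_sup [set ('E_P[f] - 'E_Q[f])%E | f in
    [set f : 'rV[R]_d -> R |
      lebesgue_rV.-integrable setT (EFin \o f) /\ (TV f <= 1)%E]].

End total_variation.

Section tests.
Context {R : realType} {d n1 n2 : nat}.

Definition expect_test (P Q : probability 'rV[R]_d R)
    (phi : n1.-tuple 'rV[R]_d * n2.-tuple 'rV[R]_d -> bool) : \bar R :=
  'E_(power_measure P n1 \x power_measure Q n2)%E[fun z => (phi z)%:R].

Definition level_test (B alpha : R)
    (phi : n1.-tuple 'rV[R]_d * n2.-tuple 'rV[R]_d -> bool) :=
  measurable_fun setT phi /\
  forall P : probability 'rV[R]_d R, in_Pinfty B n1 n2 P P ->
    (expect_test P P phi <= alpha%:E)%E.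

End tests.

(* Main.v *)
From HB Require Import structures.
Require Import Defs.
From mathcomp Require Import all_boot all_order all_algebra.
From mathcomp Require Import all_classical all_reals all_analysis.
From mathcomp Require Import measurable_realfun zify lra ring.

(** The alternatives are local bumps at an unknown place. Cut the corner
    [(0, 1 / 2) ^ d] of the unit cube into [M ^ d] cells of side
    [h = 1 / (2 M)]. For a cell [A] let [A'] be its translate by half the cube
    along the first axis, and perturb the uniform density along
    [delta = 1_A - 1_A']:

      [p = 1 + (n2 / n) * delta],   [q = 1 - (n1 / n) * delta].

    The weights are such that [(n1 * p + n2 * q) / n] is identically [1], so
    the pair always lies in the class, and [p - q = delta].

    The two distributions are far apart: by the divergence theorem on a cube,
    [1_A] has total variation at most [2 d * h ^ (d - 1)], and after division
    by that number it separates [P] from [Q] by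
    [h ^ d / (2 d * h ^ (d - 1)) = h / (2 d)] ([TV_open_box], [d_BV_step]).

    They are hard to detect: the averaged likelihood ratio [Lbar] over the
    [K = M ^ d] positions of the bump has chi-square distance to the uniform
    null about

      [((1 + 2 h ^ d * (n2 / n) ^ 2) ^ n1 * (1 + 2 h ^ d * (n1 / n) ^ 2) ^ n2)
         / K  <=  exp (2 h ^ d * n1 * n2 / n) / K],

    because bumps at different positions are orthogonal
    ([second_moment_method], [integral_bumpM]). Since
    [n1 * n2 / n <= m = min (n1, n2)], taking [h ^ d] a small multiple of
    [ln m / m] makes the exponential a small power of [m], while [K] is of
    order [m / ln m]; so the distance tends to [0] and the average over the
    positions of the power of a level-[alpha] test tends to at most [alpha].
    Some position therefore gives power at most [1 - beta], with a separation
    [h / (2 d)] of order [(ln m / m) ^ (1 / d)] ([hard_instance],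
    [grid_size]). The logarithm is the gain from not knowing the position. *)

Set Implicit Arguments.
Unset Strict Implicit.
Unset Printing Implicit Defensive.
Import Order.TTheory GRing.Theory Num.Theory.
Import numFieldNormedType.Exports HBNNSimple.
Local Open Scope classical_set_scope.
Local Open Scope ring_scope.

(** * Measures with a density *)

Section density.
Context {disp : measure_display} {T : measurableType disp} {R : realType}.
Variables (mu : {measure set T -> \bar R}) (p : T -> R).
Hypotheses (mp : measurable_fun setT p) (p0 : forall x, 0 <= p x).

(** For simple functions this is the hypothesis on sets; monotone convergence
    along an approximation of [f] extends it. *)
Lemma ge0_integral_density (nu : {measure set T -> \bar R}) (f : T -> \bar R) :
  (forall A, measurable A -> nu A = (\int[mu]_(x in A) (p x)%:E)%E) ->
  (forall x, 0 <= f x)%E -> measurable_fun setT f ->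
  (\int[nu]_x f x = \int[mu]_x (f x * (p x)%:E))%E.
Proof.
move=> nuE f0 mf; pose h := nnsfun_approx measurableT mf.
have hf x : (EFin \o h n) x @[n --> \oo] --> f x by exact: cvg_nnsfun_approx.
have mpE : measurable_fun setT (EFin \o p) by exact/measurable_EFinP.
have mh n : measurable_fun setT (EFin \o h n).
  by apply/measurable_EFinP; exact/measurable_funP.
have -> : (\int[nu]_x f x =
    limn (fun n => \int[nu]_x (EFin \o h n) x))%E.
  under eq_integral => x _ do rewrite -(cvg_lim _ (hf x))//.
  apply: monotone_convergence => //.
  - by move=> n x _; rewrite lee_fin.
  - by move=> x _ a b ab; rewrite lee_fin; exact/lefP/nd_nnsfun_approx.
have -> : (\int[mu]_x (f x * (p x)%:E) =
    limn (fun n => \int[mu]_x ((EFin \o h n) x * (p x)%:E)))%E.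
  have fg x : (f x * (p x)%:E = limn (fun n => (EFin \o h n) x * (p x)%:E))%E.
    by apply/esym/cvg_lim => //; apply: cvgeZr.
  under eq_integral => x _ do rewrite fg.
  apply: monotone_convergence => //.
  - by move=> n; exact: emeasurable_funM.
  - by move=> n x _; rewrite mule_ge0 ?lee_fin.
  - move=> x _ a b ab; rewrite lee_wpmul2r ?lee_fin//.
    exact/lefP/nd_nnsfun_approx.
apply: congr_lim; apply/funext => n /=.
under [RHS]eq_integral => x _.
  rewrite (fimfunE (h n) x) -fsumEFin// ge0_mule_fsuml; last first.
    by move=> r; rewrite EFinM; exact: nnfun_muleindic_ge0.
  over.
rewrite ge0_integral_fsum//; last 2 first.
- move=> r; apply: emeasurable_funM => //.
  by apply/measurable_EFinP; exact: measurable_funM.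
- move=> r x _; apply: mule_ge0; last by rewrite lee_fin.
  exact: nnfun_muleindic_ge0.
rewrite integralT_nnsfun sintegralE; apply: eq_fsbigr => r _.
under [RHS]eq_integral => x _ do rewrite EFinM -muleA.
have [r0|r0] := leP 0 r; last first.
  rewrite (_ : h n @^-1` [set r] = set0); last first.
    apply/seteqP; split => // x /= hr.
    by have : 0 <= h n x by []; rewrite hr leNgt r0.
  rewrite measure0 mule0; apply/esym.
  by under eq_integral do rewrite indic0 mul0e mule0; rewrite integral0.
rewrite ge0_integralZl_EFin//.
- rewrite nuE// integral_mkcond; congr (_ * _)%E.
  apply: eq_integral => x _ /=; rewrite patchE /indic.
  by case: ifPn => xr; rewrite ?mul1e ?mul0e.
- by move=> x _; rewrite mule_ge0// lee_fin.
- by apply: emeasurable_funM => //; exact/measurable_EFinP.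
Qed.

(** The two proofs are arguments so that a measure structure can be attached to
    the definition. *)
Definition density_measure of measurable_fun setT p & (forall x, 0 <= p x) :
  set T -> \bar R := fun A => (\int[mu]_(x in A) (p x)%:E)%E.

Local Notation dens := (density_measure mp p0).

Let dens0 : dens set0 = 0%E.
Proof. by rewrite /density_measure integral_set0. Qed.

Let dens_ge0 A : (0 <= dens A)%E.
Proof. by apply: integral_ge0 => x _; rewrite lee_fin. Qed.

Let dens_sigma_additive : semi_sigma_additive dens.
Proof.
move=> /= F mF tF mUF; rewrite /density_measure; apply: cvg_toP.
  apply: ereal_nondecreasing_is_cvgn => m n mn.
  apply: lee_sum_nneg_natr => // k _ _.
  by apply: integral_ge0 => /= x Fkx; rewrite lee_fin.
rewrite ge0_integral_bigcup//=.
- by apply: measurable_funTS; exact/measurable_EFinP.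
- by move=> x _; rewrite lee_fin.
Qed.

HB.instance Definition _ := isMeasure.Build _ _ _ dens
  dens0 dens_ge0 dens_sigma_additive.

Lemma probability_of_density : (\int[mu]_x (p x)%:E)%E = 1%E ->
  exists P : probability T R,
    forall A, measurable A -> P A = (\int[mu]_(x in A) (p x)%:E)%E.
Proof.
move=> p1.
pose b := Measure_isProbability.Build _ _ _ dens p1.
pose P : probability T R := HB.pack dens b.
by exists P.
Qed.

End density.

Lemma density_chain {disp : measure_display} {T : measurableType disp}
    {R : realType} (mu nu P : {measure set T -> \bar R}) (w g : T -> R) :
  measurable_fun setT w -> (forall x, 0 <= w x) ->
  measurable_fun setT g -> (forall x, 0 <= g x) ->
  (forall A, measurable A -> nu A = (\int[mu]_(x in A) (w x)%:E)%E) ->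
  (forall A, measurable A -> P A = (\int[nu]_(x in A) (g x)%:E)%E) ->
  forall A, measurable A -> P A = (\int[mu]_(x in A) (w x * g x)%:E)%E.
Proof.
move=> mw w0 mg g0 nuE PE A mA; rewrite PE// integral_mkcond.
rewrite (ge0_integral_density mw w0 nuE); last 2 first.
- by move=> x; apply: erestrict_ge0 => y _; rewrite lee_fin.
- apply/(measurable_restrictT _ _).1 => //; apply: measurable_funTS.
  exact/measurable_EFinP.
rewrite [RHS]integral_mkcond; apply: eq_integral => x _.
by rewrite !patchE; case: ifPn => _; rewrite ?mul0e// muleC.
Qed.

(** * Densities of product measures *)

Section product_integrals.
Context {disp : measure_display} {T : measurableType disp} {R : realType}.
Implicit Types mu nu : {sigma_finite_measure set T -> \bar R}.

Lemma measurable_slice_cons_pair (n : nat) (x : T) :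
  measurable_fun setT (fun t : n.-tuple T => cons_pair (x, t)).
Proof.
apply: (measurableT_comp (@measurable_cons_pair _ T n)).
exact: pair1_measurable.
Qed.

Lemma ge0_integral_power_measureS mu (n : nat) (f : n.+1.-tuple T -> \bar R) :
  measurable_fun setT f -> (forall t, 0 <= f t)%E ->
  (\int[power_measure mu n.+1]_t f t =
   \int[mu]_x \int[power_measure mu n]_t f (cons_pair (x, t)))%E.
Proof.
move=> mf f0.
have mc := @measurable_cons_pair _ T n.
transitivity (\int[mu \x power_measure mu n]_z f (cons_pair z))%E.
  by rewrite [LHS](ge0_integral_pushforward mc)//= => x _; exact: f0.
rewrite fubini_tonelli1//.
exact: (measurableT_comp mf mc).
Qed.

Lemma measurable_prod_tnth (n : nat) (g : T -> R) : measurable_fun setT g ->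
  measurable_fun setT (fun t : n.-tuple T => \prod_(i < n) g (tnth t i)).
Proof.
move=> mg; apply: measurable_prod => i _.
exact: (measurableT_comp mg (measurable_tnth i)).
Qed.

Lemma prod_tnth_cons (n : nat) (g : T -> R) (x : T) (t : n.-tuple T) :
  \prod_(i < n.+1) g (tnth (cons_pair (x, t)) i) =
  g x * \prod_(i < n) g (tnth t i).
Proof.
by rewrite big_ord_recl; congr (_ * _); apply: eq_bigr => i _; rewrite tnthS.
Qed.

(** The density of a product is the product of the densities: split off the
    first sample and apply Tonelli. *)
Lemma ge0_integral_power_density mu nu (p : T -> R) :
  measurable_fun setT p -> (forall x, 0 <= p x) ->
  (forall A, measurable A -> nu A = (\int[mu]_(x in A) (p x)%:E)%E) ->
  forall (n : nat) (f : n.-tuple T -> \bar R),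
  measurable_fun setT f -> (forall t, 0 <= f t)%E ->
  (\int[power_measure nu n]_t f t =
   \int[power_measure mu n]_t (f t * (\prod_(i < n) p (tnth t i))%:E))%E.
Proof.
move=> mp p0 nuE; have mP m := @measurable_prod_tnth m p mp.
elim=> [|n IH] f mf f0.
  rewrite !integral_dirac//= ?diracE ?in_setT ?mul1e ?big_ord0 ?mule1//.
  by apply: emeasurable_funM => //; apply/measurable_EFinP; exact: mP.
rewrite !ge0_integral_power_measureS//; last 2 first.
- by apply: emeasurable_funM => //; apply/measurable_EFinP; exact: mP.
- by move=> t; rewrite mule_ge0// lee_fin prodr_ge0.
have mfc x : measurable_fun setT (fun t : n.-tuple T => f (cons_pair (x, t))).
  exact: (measurableT_comp mf (@measurable_slice_cons_pair n x)).
have mg : measurable_fun setT (fun z : T * n.-tuple T =>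
    (f (cons_pair z) * (\prod_(i < n) p (tnth z.2 i))%:E)%E).
  apply: emeasurable_funM.
    exact: (measurableT_comp mf (@measurable_cons_pair _ T n)).
  by apply/measurable_EFinP; exact: (measurableT_comp (mP n) measurable_snd).
under eq_integral => x _ do rewrite IH//.
rewrite (ge0_integral_density mp p0 nuE)//; last 2 first.
- by move=> x; apply: integral_ge0 => t _; rewrite mule_ge0// lee_fin prodr_ge0.
- apply: (@measurable_fun_fubini_tonelli_F _ _ _ _ _
    (power_measure mu n) _ mg) => z.
  by rewrite mule_ge0// lee_fin prodr_ge0.
apply: eq_integral => x _; rewrite -ge0_integralZr//; last 3 first.
- by apply: emeasurable_funM => //; apply/measurable_EFinP; exact: mP.
- by move=> t _; rewrite mule_ge0// lee_fin prodr_ge0.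
- by rewrite lee_fin.
by apply: eq_integral => t _; rewrite prod_tnth_cons mulrC EFinM muleA.
Qed.

Lemma ge0_integral_power_prod mu (g : T -> R) (r : R) :
  measurable_fun setT g -> (forall x, 0 <= g x) ->
  (\int[mu]_x (g x)%:E = r%:E)%E -> forall n : nat,
  (\int[power_measure mu n]_t (\prod_(i < n) g (tnth t i))%:E = (r ^+ n)%:E)%E.
Proof.
move=> mg g0 gr.
have mP m := @measurable_prod_tnth m g mg.
elim=> [|n IH].
  rewrite integral_dirac//= ?diracE ?in_setT ?mul1e ?big_ord0 ?expr0//.
  by apply/measurable_EFinP; exact: mP.
rewrite ge0_integral_power_measureS; last 2 first.
- by apply/measurable_EFinP; exact: mP.
- by move=> t; rewrite lee_fin prodr_ge0.
under eq_integral => x _.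
  under eq_integral => t _ do rewrite prod_tnth_cons EFinM.
  rewrite ge0_integralZl_EFin//; last 2 first.
  - by move=> t _; rewrite lee_fin prodr_ge0.
  - apply/measurable_EFinP; exact: mP.
  rewrite IH; over.
rewrite ge0_integralZr//; last 3 first.
- exact/measurable_EFinP.
- by move=> x _; rewrite lee_fin.
- rewrite lee_fin exprn_ge0// -lee_fin -gr.
  by apply: integral_ge0 => x _; rewrite lee_fin.
by rewrite gr -EFinM exprS.
Qed.

End product_integrals.

(** * The two-sample likelihood ratio *)

Section two_samples.
Context {disp : measure_display} {T : measurableType disp} {R : realType}.
Variables n1 n2 : nat.
Implicit Types (mu nu : {sigma_finite_measure set T -> \bar R}) (a b g h : T -> R).

(** For densities [g] and [h], the likelihood ratio of the pair of samples. *)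
Definition sample_prod g h (z : n1.-tuple T * n2.-tuple T) : R :=
  (\prod_(i < n1) g (tnth z.1 i)) * (\prod_(i < n2) h (tnth z.2 i)).

Lemma measurable_sample_prod g h :
  measurable_fun setT g -> measurable_fun setT h ->
  measurable_fun setT (sample_prod g h).
Proof.
move=> mg mh; apply: measurable_funM.
  exact: (measurableT_comp (@measurable_prod_tnth _ _ _ n1 _ mg) measurable_fst).
exact: (measurableT_comp (@measurable_prod_tnth _ _ _ n2 _ mh) measurable_snd).
Qed.

Lemma sample_prod_ge0 g h z : (forall x, 0 <= g x) -> (forall x, 0 <= h x) ->
  0 <= sample_prod g h z.
Proof. by move=> g0 h0; rewrite mulr_ge0// prodr_ge0. Qed.

Lemma sample_prodM g h g' h' z :
  sample_prod g h z * sample_prod g' h' z =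
  sample_prod (g \* g') (h \* h') z.
Proof. by rewrite /sample_prod mulrACA -!big_split. Qed.

Lemma ge0_integral_sample_density mu nu1 nu2 a b
    (f : n1.-tuple T * n2.-tuple T -> \bar R) :
  measurable_fun setT a -> measurable_fun setT b ->
  (forall x, 0 <= a x) -> (forall x, 0 <= b x) ->
  (forall A, measurable A -> nu1 A = (\int[mu]_(x in A) (a x)%:E)%E) ->
  (forall A, measurable A -> nu2 A = (\int[mu]_(x in A) (b x)%:E)%E) ->
  measurable_fun setT f -> (forall z, 0 <= f z)%E ->
  (\int[power_measure nu1 n1 \x power_measure nu2 n2]_z f z =
   \int[power_measure mu n1 \x power_measure mu n2]_z
     (f z * (sample_prod a b z)%:E))%E.
Proof.
move=> ma mb a0 b0 nu1E nu2E mf f0.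
have mA := @measurable_prod_tnth _ _ _ n1 _ ma.
have mB := @measurable_prod_tnth _ _ _ n2 _ mb.
have A0 (x : n1.-tuple T) : (0 <= (\prod_(i < n1) a (tnth x i))%:E)%E.
  by rewrite lee_fin prodr_ge0.
have B0 (x : n2.-tuple T) : (0 <= (\prod_(i < n2) b (tnth x i))%:E)%E.
  by rewrite lee_fin prodr_ge0.
rewrite !fubini_tonelli1//; last 2 first.
- apply: emeasurable_funM => //; apply/measurable_EFinP.
  exact: measurable_sample_prod.
- by move=> z; rewrite mule_ge0// lee_fin sample_prod_ge0.
have mfx (x : n1.-tuple T) : measurable_fun setT (fun y => f (x, y)).
  exact: (measurableT_comp mf (pair1_measurable x)).
have mfB : measurable_fun setT (fun z : n1.-tuple T * n2.-tuple T =>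
    (f z * (\prod_(i < n2) b (tnth z.2 i))%:E)%E).
  apply: emeasurable_funM => //; apply/measurable_EFinP.
  exact: (measurableT_comp mB measurable_snd).
rewrite /fubini_F.
under eq_integral => x _ do rewrite (ge0_integral_power_density mb b0 nu2E)//.
rewrite (ge0_integral_power_density ma a0 nu1E)//; last 2 first.
- apply: (@measurable_fun_fubini_tonelli_F _ _ _ _ _
    (power_measure mu n2) _ mfB) => z.
  exact: mule_ge0.
- by move=> x; apply: integral_ge0 => y _; exact: mule_ge0.
apply: eq_integral => x _; rewrite -ge0_integralZr//; last 2 first.
- apply: emeasurable_funM => //; apply/measurable_EFinP; exact: mB.
- by move=> y _; exact: mule_ge0.
by apply: eq_integral => y _; rewrite /sample_prod mulrC EFinM muleA.
Qed.

Lemma ge0_integral_sample_prod mu g h (r s : R) :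
  measurable_fun setT g -> measurable_fun setT h ->
  (forall x, 0 <= g x) -> (forall x, 0 <= h x) ->
  (\int[mu]_x (g x)%:E = r%:E)%E -> (\int[mu]_x (h x)%:E = s%:E)%E ->
  (\int[power_measure mu n1 \x power_measure mu n2]_z (sample_prod g h z)%:E =
   (r ^+ n1 * s ^+ n2)%:E)%E.
Proof.
move=> mg mh g0 h0 gr hs.
have mG := @measurable_prod_tnth _ _ _ n1 _ mg.
have mH := @measurable_prod_tnth _ _ _ n2 _ mh.
have G0 (x : n1.-tuple T) : (0 <= (\prod_(i < n1) g (tnth x i))%:E)%E.
  by rewrite lee_fin prodr_ge0.
have H0 (x : n2.-tuple T) : (0 <= (\prod_(i < n2) h (tnth x i))%:E)%E.
  by rewrite lee_fin prodr_ge0.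
rewrite fubini_tonelli1//; last 2 first.
- by apply/measurable_EFinP; exact: measurable_sample_prod.
- by move=> z; rewrite lee_fin sample_prod_ge0.
rewrite /fubini_F /sample_prod/=.
under eq_integral => x _.
  under eq_integral => y _ do rewrite EFinM.
  rewrite ge0_integralZl_EFin//; last 2 first.
  - by apply/measurable_EFinP; exact: mH.
  - by rewrite -lee_fin.
  rewrite (ge0_integral_power_prod mh h0 hs); over.
rewrite ge0_integralZr//; last 2 first.
- by apply/measurable_EFinP; exact: mG.
- rewrite lee_fin exprn_ge0// -lee_fin -hs.
  by apply: integral_ge0 => x _; rewrite lee_fin.
by rewrite (ge0_integral_power_prod mg g0 gr).
Qed.

End two_samples.

(** * Mixtures of orthogonal perturbations are undetectable *)

Section second_moment.
Context {disp : measure_display} {T : measurableType disp} {R : realType}.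
Variables n1 n2 : nat.
Local Notation Z := (n1.-tuple T * n2.-tuple T)%type.

(** Le Cam's method with the second moment in place of the total variation
    distance. Let [L i] be the likelihood ratio of alternative [i] and [Lbar]
    their mean over [I]. The hypotheses on products say that distinct
    perturbations are orthogonal, so only the diagonal terms contribute to
    [E Lbar^2 - 1 = ((1 + s1) ^ n1 * (1 + s2) ^ n2 - 1) / #|I|], which is less
    than [e ^ 2]. Hence [E (phi * Lbar) <= E phi + E |Lbar - 1| <= alpha + e],
    and some alternative is not above this average. *)
Lemma second_moment_method (U : probability T R) (I : finType)
    (P Q : I -> probability T R) (a b : I -> T -> R) (s1 s2 alpha e : R)
    (phi : Z -> bool) :
  (0 < #|I|)%N -> 0 < e ->
  (forall i, measurable_fun setT (a i)) ->
  (forall i, measurable_fun setT (b i)) ->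
  (forall i x, 0 <= a i x) -> (forall i x, 0 <= b i x) ->
  (forall i A, measurable A -> P i A = (\int[U]_(x in A) (a i x)%:E)%E) ->
  (forall i A, measurable A -> Q i A = (\int[U]_(x in A) (b i x)%:E)%E) ->
  (forall i j, \int[U]_x (a i x * a j x)%:E = (1 + (i == j)%:R * s1)%:E)%E ->
  (forall i j, \int[U]_x (b i x * b j x)%:E = (1 + (i == j)%:R * s2)%:E)%E ->
  (1 + s1) ^+ n1 * (1 + s2) ^+ n2 < 1 + #|I|%:R * e ^+ 2 ->
  measurable_fun setT phi ->
  (\int[power_measure U n1 \x power_measure U n2]_z ((phi z)%:R : R)%:E
     <= alpha%:E)%E ->
  exists i, (\int[power_measure (P i) n1 \x power_measure (Q i) n2]_z
     ((phi z)%:R : R)%:E <= (alpha + e)%:E)%E.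
Proof.
move=> K0 e0 ma mb a0 b0 PE QE aa bb chi2 mphi lvl.
set K : R := #|I|%:R.
have {}K0 : 0 < K by rewrite ltr0n.
set V := (power_measure U n1 \x power_measure U n2)%E.
pose L i : Z -> R := sample_prod (a i) (b i).
pose S z := \sum_i L i z.
pose f z : R := (phi z)%:R.
have f0 z : 0 <= f z by [].
have mf : measurable_fun setT f.
  move=> _ Y mY.
  exact: (mphi measurableT ((fun c : bool => c%:R : R) @^-1` Y)).
have mL i : measurable_fun setT (L i) by exact: measurable_sample_prod.
have L0 i z : 0 <= L i z by exact: sample_prod_ge0.
have mS : measurable_fun setT S by exact: measurable_sum.
have S0 z : 0 <= S z by rewrite sumr_ge0.
pose E i := (\int[power_measure (P i) n1 \x power_measure (Q i) n2]_z
  (f z)%:E)%E.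
have EE i : E i = (\int[V]_z (f z * L i z)%:E)%E.
  rewrite /E (ge0_integral_sample_density (ma i) (mb i) (a0 i) (b0 i)
    (PE i) (QE i))//.
  exact/measurable_EFinP.
have intL i : (\int[V]_z (L i z)%:E = 1%:E)%E.
  rewrite -[RHS](_ : (\int[power_measure (P i) n1 \x power_measure (Q i) n2]_z
    1 = 1)%E).
    rewrite (ge0_integral_sample_density (ma i) (mb i) (a0 i) (b0 i)
      (PE i) (QE i))//.
    by under [RHS]eq_integral do rewrite mul1e.
  rewrite integral_cst//= -setXTT product_measure1E// mul1e.
  have h1 := power_measure_setT (P i) n1; have h2 := power_measure_setT (Q i) n2.
  by rewrite -[RHS](mule1 1%E); congr (_ * _)%E.
have intS : (\int[V]_z (S z)%:E = K%:E)%E.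
  under eq_integral do rewrite -sumEFin.
  rewrite ge0_integral_sum//; last 2 first.
  - by move=> i; exact/measurable_EFinP.
  - by move=> i z _; rewrite lee_fin.
  under eq_bigr do rewrite intL.
  by rewrite sumEFin sumr_const cardT -cardE.
have intfS : (\int[V]_z (f z * S z)%:E = \sum_i E i)%E.
  under eq_integral do rewrite mulr_sumr -sumEFin.
  rewrite ge0_integral_sum//; last 2 first.
  - by move=> i; apply/measurable_EFinP; exact: measurable_funM.
  - by move=> i z _; rewrite lee_fin mulr_ge0.
  by under eq_bigr do rewrite -EE.
set X := (1 + s1) ^+ n1 * (1 + s2) ^+ n2 in chi2.
have intLL i j : (\int[V]_z (L i z * L j z)%:E =
    (1 + (i == j)%:R * (X - 1))%:E)%E.
  under eq_integral do rewrite /L sample_prodM.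
  rewrite (ge0_integral_sample_prod n1 n2 (measurable_funM (ma i) (ma j))
    (measurable_funM (mb i) (mb j)) (fun x => mulr_ge0 (a0 i x) (a0 j x))
    (fun x => mulr_ge0 (b0 i x) (b0 j x)) (aa i j) (bb i j)).
  case: (i == j); rewrite ?mul1r ?mul0r ?addr0 ?expr1n ?mul1r//.
  by congr (_%:E); rewrite /X; ring.
have intSS : (\int[V]_z (S z * S z)%:E = (K * K + K * (X - 1))%:E)%E.
  under eq_integral do rewrite mulr_suml -sumEFin.
  rewrite ge0_integral_sum//; last 2 first.
  - by move=> i; apply/measurable_EFinP; exact: measurable_funM.
  - by move=> i z _; rewrite lee_fin mulr_ge0.
  rewrite (eq_bigr (fun=> (K + (X - 1))%:E)); last first.
    move=> i _; under eq_integral do rewrite mulr_sumr -sumEFin.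
    rewrite ge0_integral_sum//; last 2 first.
    - by move=> j; apply/measurable_EFinP; exact: measurable_funM.
    - by move=> j z _; rewrite lee_fin mulr_ge0.
    under eq_bigr do rewrite intLL.
    rewrite sumEFin big_split/= sumr_const -mulr_suml; congr (_ + _)%:E.
    rewrite (bigD1 i)//= eqxx big1 ?addr0 ?mul1r// => j.
    by rewrite eq_sym => /negbTE ->.
  by rewrite sumEFin sumr_const cardT -cardE -mulr_natl mulrDr.
(* The AM-GM form [phi * (Lbar - 1) <= e / 2 + (Lbar - 1) ^ 2 / (2 * e)] of
   Cauchy-Schwarz, multiplied by [2 * e * K ^ 2] with [Lbar = S / K], and with
   negative terms moved across so that both sides are nonnegative integrands. *)
have [c1 c2] : 0 <= 2 * e * K /\ 0 <= 2 * e * K ^+ 2.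
  by rewrite !mulr_ge0// ltW.
have main : (\int[V]_z ((2 * e * K)%:E * (f z * S z)%:E + (2 * K)%:E * (S z)%:E)
   <= \int[V]_z ((2 * e * K ^+ 2)%:E * (f z)%:E +
       ((S z * S z)%:E + (e ^+ 2 * K ^+ 2 + K ^+ 2)%:E)))%E.
  apply: ge0_le_integral => //.
  - by move=> z _; rewrite -!EFinM -EFinD lee_fin addr_ge0 ?mulr_ge0// ltW.
  - apply/measurable_EFinP; apply: measurable_funD; apply: measurable_funM => //.
    exact: measurable_funM.
  - apply/measurable_EFinP; apply: measurable_funD; first exact: measurable_funM.
    by apply: measurable_funD => //; exact: measurable_funM.
  - move=> z _; rewrite -!EFinM -!EFinD lee_fin /f; case: (phi z) => /=.
      have := sqr_ge0 (S z - K - e * K); nra.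
    have := sqr_ge0 (S z - K); have := sqr_ge0 (e * K); nra.
apply: contrapT => /forallNP small.
have bigE : ((K * (alpha + e))%:E <= \sum_i E i)%E.
  rewrite (_ : (K * _)%:E = \sum_(i : I) (alpha + e)%:E)%E.
    by apply: lee_sum => i _; rewrite leNgt; apply/negP => /ltW /small.
  by rewrite sumEFin sumr_const mulr_natl.
have mfE : measurable_fun setT (EFin \o f) by exact/measurable_EFinP.
have mSE : measurable_fun setT (EFin \o S) by exact/measurable_EFinP.
have mfSE : measurable_fun setT (fun z => (f z * S z)%:E).
  by apply/measurable_EFinP; exact: measurable_funM.
have mSSE : measurable_fun setT (fun z => (S z * S z)%:E).
  by apply/measurable_EFinP; exact: measurable_funM.
have K2 : 0 <= 2 * K by rewrite mulr_ge0// ltW.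
have lhs : ((2 * e * K * (K * (alpha + e)) + 2 * K * K)%:E <=
    \int[V]_z ((2 * e * K)%:E * (f z * S z)%:E + (2 * K)%:E * (S z)%:E))%E.
  rewrite ge0_integralD//; last 4 first.
  - by move=> z _; rewrite -EFinM lee_fin !mulr_ge0// ltW.
  - exact: emeasurable_funM.
  - by move=> z _; rewrite -EFinM lee_fin !mulr_ge0// ltW.
  - exact: emeasurable_funM.
  rewrite !ge0_integralZl_EFin//; last 2 first.
  - by move=> z _; rewrite lee_fin.
  - by move=> z _; rewrite lee_fin mulr_ge0.
  by rewrite intS intfS EFinD -EFinM leeD2r// EFinM lee_wpmul2l// lee_fin.
have VT : V setT = 1%E.
  rewrite /V -setXTT product_measure1E//.
  have h1 := power_measure_setT U n1; have h2 := power_measure_setT U n2.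
  by rewrite -[RHS](mule1 1%E); congr (_ * _)%E.
have intc c : (\int[V]_z c%:E = c%:E)%E.
  by rewrite integral_cst// -[RHS]mule1; congr (_ * _)%E; exact: VT.
have rhs : (\int[V]_z ((2 * e * K ^+ 2)%:E * (f z)%:E +
       ((S z * S z)%:E + (e ^+ 2 * K ^+ 2 + K ^+ 2)%:E)) <=
    (2 * e * K ^+ 2 * alpha + (K * K + K * (X - 1) + (e ^+ 2 * K ^+ 2 + K ^+ 2)))%:E)%E.
  have k0 : 0 <= e ^+ 2 * K ^+ 2 + K ^+ 2
    by rewrite -exprMn addr_ge0 // sqr_ge0.
  rewrite ge0_integralD//; last 4 first.
  - by move=> z _; rewrite -EFinM lee_fin !mulr_ge0// ltW.
  - exact: emeasurable_funM.
  - by move=> z _; rewrite -EFinD lee_fin addr_ge0// mulr_ge0.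
  - exact: emeasurable_funD.
  rewrite ge0_integralZl_EFin//; last by move=> z _; rewrite lee_fin.
  rewrite ge0_integralD//; last by move=> z _; rewrite lee_fin mulr_ge0.
  rewrite intSS intc -EFinD [leRHS]EFinD leeD2r// [leRHS]EFinM.
  by apply: lee_wpmul2l; [rewrite lee_fin | exact: lvl].
have := le_trans lhs (le_trans main rhs); rewrite lee_fin.
suff : K * (X - 1) < e ^+ 2 * K ^+ 2 by nra.
by rewrite [ltRHS]mulrC expr2 -mulrA ltr_pM2l// ltrBlDl.
Qed.

End second_moment.

(** * Continuous functions on R^d are measurable *)

Section borel_rV.
Context {R : realType} {d : nat}.

(** Second countability: an open set is the union of the cubes with rational
    centre and radius [1 / (k + 1)] that it contains. *)
Lemma open_measurable_rV (V : set 'rV[R]_d) : open V -> measurable V.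
Proof.
move=> oV.
pose box (qk : 'rV[rat]_d * nat) : set 'rV[R]_d :=
  [set x | forall i, ball (ratr (qk.1 ord0 i) : R) (qk.2.+1%:R^-1) (x ord0 i)].
rewrite (_ : V = \bigcup_(qk in [set: 'rV[rat]_d * nat])
    (if pselect (box qk `<=` V) then box qk else set0)); last first.
  apply/seteqP; split => [x Vx|x]; last first.
    by move=> [qk _]; case: pselect => // sub; exact: sub.
  have /nbhs_ballP[e /= e0 xeV] : nbhs x V by exact: open_nbhs_nbhs.
  (* Half of [e]: both [x] and any other point of the cube are within
     [1 / (k + 1)] of the centre. *)
  have [k ke] : exists k, (k.+1%:R^-1 : R) < e / 2.
    have [N _ hN] := near_infty_natSinv_lt (PosNum (divr_gt0 e0 (ltr0n _ 2))).
    by exists N; exact: (hN N (leqnn N)).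
  have /choice[q hq] i : exists r : rat,
      ball (ratr r : R) (k.+1%:R^-1) (x ord0 i).
    have : x ord0 i - k.+1%:R^-1 < x ord0 i + k.+1%:R^-1.
      by rewrite ltrBlDr -addrA ltrDl -mulr2n mulrn_wgt0.
    move=> /rat_in_itvoo[r]; rewrite in_itv/= -ltr_distl => xr.
    by exists r; rewrite /ball/=.
  exists (\row_i q i, k) => //.
  case: pselect => [sub|]; first by move=> i; rewrite mxE; exact: hq.
  case=> y; rewrite /box/= => yb; apply: xeV; split => // i j.
  rewrite ord1; have := hq j; have := yb j; rewrite mxE /ball/= => h1 h2.
  rewrite -(subrKA (ratr (q j))) (le_lt_trans (ler_normD _ _))//.
  by rewrite [ltRHS]splitr ltrD// ?(lt_trans _ ke)// distrC.
apply: countable_bigcupT_measurable => // qk; case: pselect => /= [sub|//].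
rewrite (_ : box qk = \bigcap_(i in [set: 'I_d])
    (fun x : 'rV[R]_d => x ord0 i) @^-1`
       ball (ratr (qk.1 ord0 i) : R) (qk.2.+1%:R^-1)).
  apply: fin_bigcap_measurable; first exact: finite_finset.
  move=> i _; rewrite -[X in measurable X]setTI.
  by apply: measurable_coord_rV => //; apply: measurable_ball.
by apply/seteqP; split => t /= h i; [move=> _; exact: h|exact: (h i I)].
Qed.

Lemma continuous_measurable_rV (f : 'rV[R]_d -> R) :
  continuous f -> measurable_fun setT f.
Proof.
move=> cf; apply: (measurability _ (RGenOpens.measurableE R)) => _ [_ [u [v ->]] <-].

rewrite setTI; apply: open_measurable_rV.
by apply: open_comp; [move=> x _; exact: cf | exact: interval_open].
Qed.

End borel_rV.

(** * Integrals over a cube from their one-dimensional slices *)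

Section slices.
Context {disp : measure_display} {T : measurableType disp} {R : realType}.
Variable mu : {sigma_finite_measure set T -> \bar R}.

Definition tuple_box (n : nat) (D : 'I_n -> set T) : set (n.-tuple T) :=
  [set t | forall j, D j (tnth t j)].

Definition replace_tnth (n : nat) (i : 'I_n) (x : T) (t : n.-tuple T) :
  n.-tuple T := [tuple if j == i then x else tnth t j | j < n].

Lemma measurable_tuple_box (n : nat) (D : 'I_n -> set T) :
  (forall j, measurable (D j)) -> measurable (tuple_box D).
Proof.
move=> mD; rewrite (_ : tuple_box D = \bigcap_(i in [set: 'I_n])
    (fun t : n.-tuple T => tnth t i) @^-1` D i).
  apply: fin_bigcap_measurable; first exact: finite_finset.
  by move=> i _; rewrite -[X in measurable X]setTI; exact: measurable_tnth.
by apply/seteqP; split => t /= h i; [move=> _; exact: h|exact: (h i I)].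
Qed.

Lemma power_measure_cube (n : nat) (D : 'I_n -> set T) (h : R) :
  (forall j, measurable (D j)) -> (forall j, mu (D j) = h%:E) ->
  power_measure mu n (tuple_box D) = (h ^+ n)%:E.
Proof.
move=> mD hD; rewrite power_measure_box//.
under eq_bigr do rewrite hD.
by rewrite prodEFin prodr_const card_ord.
Qed.

Lemma replace_tnth_head (n : nat) (x y : T) (t : n.-tuple T) :
  replace_tnth ord0 x (cons_pair (y, t)) = cons_pair (x, t).
Proof.
apply: eq_from_tnth => j; rewrite tnth_mktuple.
by have [k ->|->] := unliftP ord0 j; rewrite ?eqxx// !tnthS.
Qed.

Lemma replace_tnth_behead (n : nat) (i : 'I_n) (x y : T) (t : n.-tuple T) :
  replace_tnth (lift ord0 i) x (cons_pair (y, t)) =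
  cons_pair (y, replace_tnth i x t).
Proof.
apply: eq_from_tnth => j; rewrite tnth_mktuple.
have [k ->|->] := unliftP ord0 j; last by [].
by rewrite !tnthS (inj_eq lift_inj) tnth_mktuple.
Qed.

Section bounded_on_box.
Variables (n : nat) (D : 'I_n.+1 -> set T) (G : n.+1.-tuple T -> R) (h C : R).
Hypotheses (mD : forall j, measurable (D j)) (hD : forall j, mu (D j) = h%:E).
Hypotheses (mG : measurable_fun setT G)
  (GC : forall t, `|G t| <= C * \1_(tuple_box D) t).

Let G' (z : T * n.-tuple T) : \bar R := (G (cons_pair z))%:E.

Lemma integrable_box_cons_pair :
  (mu \x power_measure mu n)%E.-integrable setT G'.
Proof.
have mB := measurable_tuple_box mD.
have mcB : measurable (@cons_pair _ T n @^-1` tuple_box D).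
  by rewrite -[X in measurable X]setTI; exact: measurable_cons_pair.
apply: (@le_integrable _ _ _ _ _ _ _ (fun z : T * n.-tuple T => (C%:E *
    (\1_(@cons_pair _ T n @^-1` tuple_box D) z)%:E)%E)) => //.
- apply/measurable_EFinP; apply: (measurableT_comp mG).
  exact: measurable_cons_pair.
- move=> z _; rewrite /G' -EFinM !abse_EFin lee_fin.
  by rewrite (le_trans (GC _))// ler_norm.
apply: integrableZl => //; apply/integrableP; split.
  exact/measurable_EFinP/measurable_indic.
under eq_integral do rewrite abse_EFin ger0_norm//.
rewrite integral_indic// setIT.
suff : (power_measure mu n.+1 (tuple_box D) < +oo)%E by [].
by rewrite (power_measure_cube mD hD) ltry.
Qed.

Lemma integral_power_measureS :
  (\int[power_measure mu n.+1]_t (G t)%:E =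
   \int[mu \x power_measure mu n]_z G' z)%E.
Proof.
rewrite (integral_pushforward (@measurable_cons_pair _ T n))//.
- exact/measurable_EFinP.
- exact: integrable_box_cons_pair.
Qed.

Let D' j := D (lift ord0 j).

Lemma tuple_box_cons (x : T) (t : n.-tuple T) :
  tuple_box D (cons_pair (x, t)) <-> D ord0 x /\ tuple_box D' t.
Proof.
split=> [Dxt|[Dx Dt] j].
  by split=> [|j]; [exact: (Dxt ord0)|have := Dxt (lift ord0 j); rewrite tnthS].
by have [k ->|->] := unliftP ord0 j; rewrite ?tnthS; [exact: Dt|exact: Dx].
Qed.

Lemma out_of_box0 (t : n.+1.-tuple T) : ~ tuple_box D t -> G t = 0.
Proof.
move=> tD; apply/eqP; rewrite -normr_le0 (le_trans (GC t))// indicE memNset//.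
by rewrite mulr0.
Qed.

Lemma integral_head_slice_bound (M : R) :
  0 <= M ->
  (forall t, `|\int[mu]_x (G (cons_pair (x, t)))%:E| <= M%:E)%E ->
  (`|\int[power_measure mu n.+1]_t (G t)%:E| <= (M * h ^+ n)%:E)%E.
Proof.
move=> M0 GM; have iG := integrable_box_cons_pair.
rewrite integral_power_measureS -integral21_prod_meas1//.
have mD' j : measurable (D' j) by exact: mD.
have hD' j : mu (D' j) = h%:E by exact: hD.
apply: le_trans (le_abse_integral _ _ _) _ => //.
  exact: (measurable_fubini_G iG).
apply: (@le_trans _ _ (\int[power_measure mu n]_t
    (M%:E * (\1_(tuple_box D') t)%:E)))%E.
  apply: ge0_le_integral => //.
  - apply: measurableT_comp => //.
    exact: (measurable_fubini_G iG).
  - apply: emeasurable_funM => //; apply/measurable_EFinP/measurable_indic.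
    exact: measurable_tuple_box.
  - move=> t _; rewrite indicE; have [tD|tD] := pselect (tuple_box D' t).
      by rewrite mem_set// mule1; exact: GM.
    rewrite memNset// mule0 /fubini_G.
    under eq_integral.
      move=> x _; rewrite /G' out_of_box0; last by move=> /tuple_box_cons[].
      over.
    by rewrite integral0 abse0.
have mB := measurable_tuple_box mD'.
have mI : measurable_fun setT (EFin \o \1_(tuple_box D') : _ -> \bar R).
  exact/measurable_EFinP/measurable_indic.
have I0 x : (0 <= (\1_(tuple_box D') x : R)%:E)%E by rewrite lee_fin.
rewrite ge0_integralZl_EFin// integral_indic// setIT.
by have := power_measure_cube mD' hD'; rewrite /= => ->; rewrite EFinM.
Qed.

End bounded_on_box.

(** Fubini in the [i]-th variable. The [n]-fold product measure is built by
    adding variables in front, so the induction peels off leading variables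
    until the [i]-th one is first. The bound by an indicator makes all slices
    integrable, not only almost all of them. The point [x0] fills the
    [i]-th place of a tuple whose [i]-th entry is about to be replaced. *)
Lemma integral_slice_bound (x0 : T) (n : nat) (i : 'I_n.+1) (D : 'I_n.+1 -> set T)
    (G : n.+1.-tuple T -> R) (h C M : R) :
  0 <= h -> 0 <= M ->
  (forall j, measurable (D j)) -> (forall j, mu (D j) = h%:E) ->
  measurable_fun setT G -> (forall t, `|G t| <= C * \1_(tuple_box D) t) ->
  (forall t, `|\int[mu]_x (G (replace_tnth i x t))%:E| <= M%:E)%E ->
  (`|\int[power_measure mu n.+1]_t (G t)%:E| <= (M * h ^+ n)%:E)%E.
Proof.
move=> h0 M0; elim: n i D G => [|n IH] i D G mD hD mG GC GM.
  apply: (integral_head_slice_bound mD hD mG GC M0) => t.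
  have := GM (cons_pair (x0, t)); rewrite ord1.
  by under eq_integral do rewrite replace_tnth_head.
have [j ij|i0] := unliftP ord0 i; last first.
  apply: (integral_head_slice_bound mD hD mG GC M0) => t.
  have := GM (cons_pair (x0, t)); rewrite i0.
  by under eq_integral do rewrite replace_tnth_head.
have iG := integrable_box_cons_pair mD hD mG GC.
rewrite (integral_power_measureS mD hD mG GC) -integral12_prod_meas1//.
apply: le_trans (le_abse_integral _ _ _) _ => //.
  exact: (measurable_fubini_F iG).
apply: (@le_trans _ _ (\int[mu]_x ((M * h ^+ n)%:E * (\1_(D ord0) x)%:E)))%E.
  apply: ge0_le_integral => //.
  - apply: measurableT_comp => //.
    exact: (measurable_fubini_F iG).
  - by apply: emeasurable_funM => //; exact/measurable_EFinP/measurable_indic.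
  - move=> x _; rewrite indicE; have [xD|xD] := pselect (D ord0 x).
      rewrite mem_set// mule1 /fubini_F.
      apply: (IH j (fun k => D (lift ord0 k))) => //.
      + exact: (measurableT_comp mG (@measurable_slice_cons_pair _ _ n.+1 x)).
      + move=> t; rewrite (le_trans (GC _))//.
        suff : \1_(tuple_box D) (cons_pair (x, t)) =
          \1_(tuple_box (fun k => D (lift ord0 k))) t :> R by move=> ->.
        rewrite !indicE; congr (_%:R); congr nat_of_bool.
        apply/idP/idP; rewrite !inE; first by move=> /tuple_box_cons[].
        by move=> ?; apply/tuple_box_cons.
      + move=> t; have := GM (cons_pair (x, t)); rewrite ij.
        by under eq_integral do rewrite replace_tnth_behead.
    rewrite memNset// mule0 /fubini_F.
    under eq_integral.
      move=> t _; rewrite (out_of_box0 GC); last by move=> /tuple_box_cons[].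
      over.
    by rewrite integral0 abse0.
have mI : measurable_fun setT (EFin \o \1_(D ord0) : T -> \bar R).
  exact/measurable_EFinP/measurable_indic.
have I0 x : (0 <= (\1_(D ord0) x : R)%:E)%E by rewrite lee_fin.
have Mh : 0 <= M * h ^+ n by rewrite mulr_ge0// exprn_ge0.
rewrite ge0_integralZl_EFin//.
rewrite integral_indic// setIT.
by have := hD ord0; rewrite /= => ->; rewrite -EFinM -mulrA -exprSr.
Qed.

End slices.

(** * Total variation of the indicator of a cube *)

Section coordinate_lines.
Context {R : realType} {n : nat}.
Variables (i : 'I_n.+1) (t : n.+1.-tuple R).

Definition coord_line (s : R) : 'rV[R]_n.+1 :=
  row_of_tuple (replace_tnth i s t).

Lemma coord_lineD (s h : R) :
  coord_line (h + s) = h *: delta_mx ord0 i + coord_line s.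
Proof.
apply/rowP => j; rewrite !mxE !tnth_mktuple.
by case: (j == i); rewrite /= ?mulr1 ?mulr0 ?add0r.
Qed.

(** Both derivatives below are limits of the same difference quotient. *)
Let quotient_coord_line (f : 'rV[R]_n.+1 -> R) (s : R) :
  (fun h => h^-1 *: (((f \o coord_line) \o shift s) (h *: 1) -
                     (f \o coord_line) s)) =
  (fun h => h^-1 *: ((f \o shift (coord_line s)) (h *: delta_mx ord0 i) -
                     f (coord_line s))).
Proof.
by apply/funext => h /=; rewrite /shift/= [h *: 1]mulr1 coord_lineD.
Qed.

Lemma derive_coord_line (f : 'rV[R]_n.+1 -> R) (s : R) :
  'D_1 (f \o coord_line) s = 'D_(delta_mx ord0 i) f (coord_line s).
Proof. by rewrite /derive quotient_coord_line. Qed.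

Lemma derivable_coord_line (f : 'rV[R]_n.+1 -> R) (s : R) :
  derivable f (coord_line s) (delta_mx ord0 i) ->
  derivable (f \o coord_line) s 1.
Proof. by rewrite /derivable quotient_coord_line. Qed.

Lemma continuous_coord_line : continuous coord_line.
Proof.
rewrite (_ : coord_line = fun s => s *: delta_mx ord0 i + coord_line 0).
  by move=> s; apply: cvgD; [apply: cvgZ; [exact: cvg_id|exact: cvg_cst]|exact: cvg_cst].
by apply/funext => s; rewrite -coord_lineD addr0.
Qed.

End coordinate_lines.

(** By the fundamental theorem of calculus the integral is
    [F (a + h) - F a]. *)
Lemma integral_derive_le2 {R : realType} (F f : R -> R) (a h : R) : 0 < h ->
  (forall s, derivable F s 1) -> (forall s, 'D_1 F s = f s) -> continuous f ->
  (forall s, `|F s| <= 1) ->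
  (`|\int[lebesgue_measure]_(s in `]a, (a + h)%R[) (f s)%:E| <= 2%:E)%E.
Proof.
move=> h0 dF F'f cf F1.
have cF : continuous F.
  by move=> s; apply: differentiable_continuous; apply/derivable1_diffP.
have aah : a < a + h by rewrite ltrDl.
rewrite -(integral_itv_bndoo true false); last first.
  apply: measurable_funTS; apply/measurable_EFinP.
  exact: continuous_measurable_fun.
rewrite (@continuous_FTC2 _ f F)//.
- rewrite -EFinB abse_EFin lee_fin (le_trans (ler_normB _ _))//.
  by rewrite (natrD _ 1 1) lerD.
- exact: continuous_subspaceT.
- split; first by move=> s _; exact: dF.
    exact: cvg_at_right_filter (cF _).
  exact: cvg_at_left_filter (cF _).
- by move=> s _; rewrite derive1E F'f.
Qed.

Lemma integral_lebesgue_rV {R : realType} (d : nat) (f : 'rV[R]_d -> \bar R) :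
  lebesgue_rV.-integrable setT f ->
  (\int[lebesgue_rV]_x f x =
   \int[power_measure lebesgue_measure d]_t f (row_of_tuple t))%E.
Proof.
move=> fi; have mf := measurable_int _ fi.
have mr : measurable_fun [set: d.-tuple (measurableTypeR R)]
    (@row_of_tuple R d : d.-tuple (measurableTypeR R) -> 'rV[R]_d).
  exact: measurable_row_of_tuple.
pose P : {measure set (d.-tuple (measurableTypeR R)) -> \bar R} :=
  power_measure lebesgue_measure d.
have iP : P.-integrable setT (f \o @row_of_tuple R d).
  apply/integrableP; split; first exact: measurableT_comp.
  have /integrableP[_] := fi.
  have mabs : measurable_fun setT (abse \o f) by exact: measurableT_comp.
  have := @ge0_integral_pushforward _ _ _ _ _ _ mr P setT (abse \o f)
    measurableT mabs (fun x _ => abse_ge0 (f x)).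
  by move=> <-.
exact: (@integral_pushforward _ _ _ _ _ _ mr P setT f mf iP measurableT).
Qed.

Section total_variation_of_a_box.
Context {R : realType} {n : nat}.
Implicit Types (u : 'I_n.+1 -> R) (h : R).

Definition open_box u h : set 'rV[R]_n.+1 :=
  [set x | forall i, `]u i, u i + h[%classic (x ord0 i)].

Lemma lebesgue_side (a h : R) : 0 < h ->
  lebesgue_measure (`]a, a + h[%classic : set R) = h%:E.
Proof.
move=> h0; rewrite lebesgue_measure_itv/= lte_fin ltrDl h0.
by rewrite -EFinB; congr (_%:E); ring.
Qed.

Lemma measurable_open_box u h : measurable (open_box u h).
Proof.
rewrite (_ : open_box u h = \bigcap_(i in [set: 'I_n.+1])
    (fun x : 'rV[R]_n.+1 => x ord0 i) @^-1` `]u i, u i + h[%classic).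
  apply: fin_bigcap_measurable; first exact: finite_finset.
  move=> i _; rewrite -[X in measurable X]setTI.
  exact: measurable_coord_rV.
by apply/seteqP; split => t /= b i; [move=> _; exact: b|exact: (b i I)].
Qed.

Lemma lebesgue_open_box u h : 0 < h ->
  lebesgue_rV (open_box u h) = (h ^+ n.+1)%:E.
Proof.
move=> h0.
transitivity (\prod_(i < n.+1)
    lebesgue_measure (`]u i, (u i + h)%R[%classic : set R))%E.
  by apply: lebesgue_rV_box => i; exact: measurable_itv.
under eq_bigr do rewrite lebesgue_side//.
by rewrite prodEFin prodr_const card_ord.
Qed.

Section test_field.
Variable phi : 'rV[R]_n.+1 -> 'rV[R]_n.+1.
Hypotheses (dphi : forall x, differentiable phi x)
  (cphi : continuous (jacobian phi)) (phi1 : forall x, norm2 (phi x) <= 1).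

Let partial (i : 'I_n.+1) (x : 'rV[R]_n.+1) : R :=
  'D_(delta_mx ord0 i) (fun y => phi y ord0 i) x.

Lemma component_le1 i x : `|phi x ord0 i| <= 1.
Proof.
apply: le_trans (phi1 x); rewrite -sqrtr_sqr ler_wsqrtr//.
by rewrite (bigD1 i)//= lerDl sumr_ge0// => j _; rewrite sqr_ge0.
Qed.

Lemma derivable_component i x v : derivable (fun y => phi y ord0 i) x v.
Proof.
by have /derivable_mxP := @diff_derivable _ _ _ _ _ v (dphi x); exact.
Qed.

Lemma partialE i x : partial i x = jacobian phi x i i.
Proof.
have := deriveEjacobian (delta_mx ord0 i) (dphi x).
rewrite derive_mx; last exact: diff_derivable.
by move=> /matrixP/(_ ord0 i); rewrite mxE -rowE mxE.
Qed.

Lemma continuous_partial i : continuous (partial i).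
Proof.
rewrite (_ : partial i = (fun M : 'M[R]_n.+1 => M i i) \o jacobian phi).
  move=> x; apply: continuous_comp; first exact: cphi.
  exact: coord_continuous.
by apply/funext => x; exact: partialE.
Qed.

Lemma measurable_partial i : measurable_fun setT (partial i).
Proof. by apply: continuous_measurable_rV; exact: continuous_partial. Qed.

Lemma bounded_partial i u h : 0 < h -> exists2 C, 0 <= C &
  forall x, open_box u h x -> `|partial i x| <= C.
Proof.
move=> h0.
pose K := [set x : 'rV[R]_n.+1 | forall i, `[u i, u i + h]%classic (x ord0 i)].
have K0 : K !=set0.
  exists (\row_i u i) => j /=.
  by rewrite mxE in_itv/= lexx lerDl ltW.
have cK : compact K.
  exact: (@rV_compact R n.+1 (fun j => `[u j, u j + h]%classic)
      (fun j => @segment_compact R (u j) (u j + h))).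
have cf : {within K, continuous (fun x => `|partial i x|)}.
  apply: continuous_subspaceT => x.
  apply: (@continuous_comp _ _ _ (partial i) (fun y : R => `|y|)).
    exact: continuous_partial.
  exact: norm_continuous.
have [c cc cmax] := EVT_max_rV K0 cK cf.
exists `|partial i c| => // x xb; apply: cmax; rewrite inE => j.
by apply: subset_itv_oo_cc; exact: xb.
Qed.

Lemma integral_partial_coord_line i (t : n.+1.-tuple R) (a h : R) : 0 < h ->
  (`|\int[lebesgue_measure]_(s in `]a, (a + h)%R[)
      (partial i (coord_line i t s))%:E| <= 2%:E)%E.
Proof.
move=> h0.
apply: (@integral_derive_le2 _ ((fun y => phi y ord0 i) \o coord_line i t)) => //.
- by move=> s; apply: derivable_coord_line; exact: derivable_component.
- by move=> s; rewrite derive_coord_line.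
- move=> s; apply: continuous_comp; first exact: continuous_coord_line.
  exact: continuous_partial.
- by move=> s; exact: component_le1.
Qed.

Lemma integrable_box_partial i u h : 0 < h ->
  lebesgue_rV.-integrable setT
    (fun x => (\1_(open_box u h) x * partial i x)%:E).
Proof.
move=> h0; have [C C0 hC] := bounded_partial i u h0.
have mb := @measurable_open_box u h.
apply: (@le_integrable _ _ _ _ _ _ _
   (fun x => (C%:E * (\1_(open_box u h) x)%:E)%E)) => //.
- apply/measurable_EFinP; apply: measurable_funM.
    exact: measurable_indic.
  exact: measurable_partial.
- move=> x _; rewrite -EFinM !abse_EFin lee_fin indicE.
  have [xb|xb] := pselect (open_box u h x).
    by rewrite mem_set// mul1r mulr1 (le_trans (hC _ xb))// ler_norm.
  by rewrite memNset// mul0r mulr0.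
apply: integrableZl => //; apply/integrableP; split.
  exact/measurable_EFinP/measurable_indic.
under eq_integral do rewrite abse_EFin ger0_norm//.
rewrite integral_indic// setIT.
by have := lebesgue_open_box u h0; rewrite /= => ->; rewrite ltry.
Qed.

(** The flux through the two faces orthogonal to the [i]-th axis: each line in
    that direction contributes at most [2], and these lines sweep an
    [n]-dimensional cube of volume [h ^ n]. *)
Lemma integral_box_partial i u h : 0 < h ->
  (`|\int[lebesgue_rV]_x (\1_(open_box u h) x * partial i x)%:E| <=
    (2 * h ^+ n)%:E)%E.
Proof.
move=> h0; have ip := integrable_box_partial i u h0.
rewrite (integral_lebesgue_rV ip)/=.
have [C C0 hC] := bounded_partial i u h0.
pose D j : set R := `]u j, u j + h[%classic.
have boxE t : open_box u h (row_of_tuple t) = tuple_box D t.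
  by apply/propext; split=> b j; have := b j; rewrite mxE.
apply: (@integral_slice_bound _ (measurableTypeR R) R lebesgue_measure 0 n i D
  (fun t => \1_(open_box u h) (row_of_tuple t) * partial i (row_of_tuple t))
  h C 2) => //.
- exact: ltW.
- by move=> j; exact: measurable_itv.
- by move=> j; exact: lebesgue_side.
- apply: (@measurableT_comp _ _ _ _ _ _
    (fun x => \1_(open_box u h) x * partial i x)) => //.
  apply: measurable_funM; last exact: measurable_partial.
  by apply: measurable_indic; exact: measurable_open_box.
- exact: measurable_row_of_tuple.
- move=> t; rewrite !indicE; have [tD|tD] := pselect (tuple_box D t).
    by rewrite !mem_set ?boxE// mul1r mulr1 hC// boxE.
  by rewrite !memNset ?boxE// mul0r mulr0 normr0.
(* The line through [t] in direction [i] misses the cube, or meets it in the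
   full segment of length [h]. *)
- move=> t; have [tD|/existsNP[j /not_implyP[ji tj]]] :=
      pselect (forall j, j != i -> D j (tnth t j)); last first.
    under eq_integral.
      move=> s _; rewrite indicE memNset; last first.
        by rewrite boxE => /(_ j); rewrite tnth_mktuple (negbTE ji).
      rewrite mul0r; over.
    by rewrite integral0 abse0 lee_fin.
  rewrite (_ : (\int[_]_x _ = \int[lebesgue_measure]_(s in `]u i, (u i + h)%R[)
      (partial i (coord_line i t s))%:E)%E); first exact: integral_partial_coord_line.
  rewrite [RHS]integral_mkcond; apply: eq_integral => s _.
  rewrite patchE indicE /coord_line.
  have -> : (row_of_tuple (replace_tnth i s t) \in open_box u h) =
      (s \in (`]u i, (u i + h)%R[%classic : set R)).
    apply/idP/idP; rewrite !inE boxE.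
      by move=> /(_ i); rewrite tnth_mktuple eqxx.
    move=> sD j; rewrite tnth_mktuple; case: eqVneq => [->//|ji].
    exact: tD.
  by case: ifPn; rewrite ?mul1r ?mul0r.
Qed.

Let box_divergenceE u h x :
  (\1_(open_box u h) x * divergence phi x)%:E =
  (\sum_(i < n.+1) (\1_(open_box u h) x * partial i x)%:E)%E.
Proof. by rewrite mulr_sumr -sumEFin. Qed.

Lemma integrable_box_divergence u h : 0 < h -> lebesgue_rV.-integrable setT
  (fun x => (\1_(open_box u h) x * divergence phi x)%:E).
Proof.
move=> h0; under eq_fun do rewrite box_divergenceE.
by apply: integrable_sum => // i _; exact: integrable_box_partial.
Qed.

Lemma integral_box_divergence u h : 0 < h ->
  (\int[lebesgue_rV]_x (\1_(open_box u h) x * divergence phi x)%:E <=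
    (n.+1%:R * (2 * h ^+ n))%:E)%E.
Proof.
move=> h0.
under eq_integral => x _ do rewrite box_divergenceE.
rewrite integral_sum//; last by move=> i; exact: integrable_box_partial.
rewrite (_ : (n.+1%:R * (2 * h ^+ n))%:E = \sum_(i < n.+1) (2 * h ^+ n)%:E)%E.
  apply: lee_sum => i _; apply: le_trans (lee_abs _) _.
  exact: integral_box_partial.
by rewrite sumEFin sumr_const card_ord mulr_natl.
Qed.

End test_field.

(** The perimeter of the cube bounds its total variation: the dimension is
    [n.+1], and each direction contributes two faces of area [h ^ n]. *)
Lemma TV_open_box (c : R) u h : 0 <= c -> 0 < h ->
  (TV (fun x : 'rV[R]_n.+1 => (c * \1_(open_box u h) x)%R) <=
    (c * (n.+1%:R * (2 * h ^+ n)))%:E)%E.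
Proof.
move=> c0 h0; apply: ge_ereal_sup => _ [phi [[dphi cphi _] phi1] <-].
have mb := @measurable_open_box u h.
under eq_integral => x _ do rewrite -mulrA EFinM.
rewrite integralZl//; last first.
  exact: integrable_box_divergence.
rewrite EFinM lee_wpmul2l ?lee_fin//.
exact: integral_box_divergence.
Qed.

End total_variation_of_a_box.

(** * Perturbations that are constant on disjoint cells *)

Section step_functions.
Context {disp : measure_display} {T : measurableType disp} {R : realType}.
Variables (U : probability T R) (J : finType) (cell : J -> set T) (v : R).
Hypotheses (mcell : forall p, measurable (cell p))
  (disjcell : forall p q x, cell p x -> cell q x -> p = q)
  (Ucell : forall p, U (cell p) = v%:E).

(** Normalised to [1] off the cells, so that it is a perturbation of the
    density of [U] itself. *)
Definition step (c : J -> R) (x : T) : R := 1 + \sum_p c p * \1_(cell p) x.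

Lemma step_in (c : J -> R) (p : J) (x : T) : cell p x -> step c x = 1 + c p.
Proof.
move=> px; rewrite /step (bigD1 p)//= indicE mem_set// mulr1 big1 ?addr0//.
move=> q qp; rewrite indicE memNset ?mulr0// => qx.
by move/eqP : qp; apply; exact: disjcell qx px.
Qed.

Lemma step_out (c : J -> R) (x : T) : (forall p, ~ cell p x) -> step c x = 1.
Proof.
by move=> nx; rewrite /step big1 ?addr0// => p _; rewrite indicE memNset ?mulr0.
Qed.

Lemma stepP (x : T) : (exists2 p, cell p x & forall c, step c x = 1 + c p) \/
  (forall c, step c x = 1).
Proof.
have [[p px]|/forallNP nx] := pselect (exists p, cell p x); [left|right].
  by exists p => // c; exact: step_in.
by move=> c; exact: step_out.
Qed.

(** The cells are disjoint, so the coefficients multiply cell by cell. *)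
Lemma stepM (a b : J -> R) (x : T) :
  step a x * step b x = step (fun p => a p + b p + a p * b p) x.
Proof. by case: (stepP x) => [[p _ E]|E]; rewrite !E; ring. Qed.

Lemma step_ge0 (c : J -> R) (x : T) : (forall p, -1 <= c p) -> 0 <= step c x.
Proof.
by move=> c1; case: (stepP x) => [[p _ ->]|->//]; rewrite -lerBlDl sub0r.
Qed.

Lemma measurable_step (c : J -> R) : measurable_fun setT (step c).
Proof.
apply: measurable_funD => //; apply: measurable_sum => p.
by apply: measurable_funM => //; exact: measurable_indic.
Qed.

Lemma integral_step (c : J -> R) :
  (\int[U]_x (step c x)%:E = (1 + v * \sum_p c p)%:E)%E.
Proof.
under eq_integral do rewrite EFinD -sumEFin.
have ic p : U.-integrable setT (fun x => (c p * \1_(cell p) x)%:E).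
  under eq_fun do rewrite EFinM.
  by apply: integrableZl => //; exact: integrable_indic.
rewrite integralD//; last by apply: integrable_sum => // p _; exact: ic.
  rewrite integral_cst//= probability_setT mule1 integral_sum//.
  rewrite EFinD; congr (_ + _)%E; rewrite mulr_sumr -sumEFin.
  apply: eq_bigr => p _; under eq_integral do rewrite EFinM.
  rewrite integralZl//; last exact: integrable_indic.
  rewrite integral_indic// setIT.
  by have := Ucell p; rewrite /= => ->; rewrite -EFinM mulrC.
by apply/integrableP; split => //; rewrite integral_cst//= probability_setT mule1 ltry.
Qed.

Lemma integral_step_cell (c : J -> R) (p : J) :
  (\int[U]_(x in cell p) (step c x)%:E = ((1 + c p) * v)%:E)%E.
Proof.
rewrite (eq_integral (fun=> (1 + c p)%:E)).
  rewrite integral_cst//.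
  by have := Ucell p; rewrite /= => ->; rewrite EFinM.
by move=> x; rewrite inE => px; rewrite (step_in _ px).
Qed.

End step_functions.

(** * A grid of cells in the unit cube *)

Section grid.
Context {R : realType}.
Variables n M : nat.
Hypothesis M0 : (0 < M)%N.

Local Notation J := (bool * {ffun 'I_n.+1 -> 'I_M})%type.

(** The integer corner of a cell. The index [k] ranges over the cells of the
    lower half cube, and the boolean tells a cell from its translate by half
    the cube ([M] mesh widths) along the first axis; both families together
    are indexed injectively. *)
Definition corner (p : J) (i : 'I_n.+1) : nat :=
  (p.2 i + (p.1 && (i == ord0)) * M)%N.

Definition mesh : R := (2 * M)%:R^-1.

Definition grid_cell (p : J) : set 'rV[R]_n.+1 :=
  open_box (fun i => (corner p i)%:R * mesh) mesh.

Lemma mesh_gt0 : 0 < mesh.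
Proof. by rewrite invr_gt0 ltr0n muln_gt0. Qed.

Lemma corner_inj (p q : J) : corner p =1 corner q -> p = q.
Proof.
case: p q => [b k] [b' k'] E; have := E ord0.
rewrite /corner/= eqxx !andbT => E0.
have := ltn_ord (k ord0); have := ltn_ord (k' ord0) => lt' lt.
have bb : b = b' by case: b b' E E0 => -[] //= _; lia.
rewrite bb in E *; congr pair; apply/ffunP => i; apply/val_inj.
by have := E i; rewrite /corner/= => /addIn.
Qed.

Lemma grid_cell_disj (p q : J) (x : 'rV[R]_n.+1) :
  grid_cell p x -> grid_cell q x -> p = q.
Proof.
move=> px qx; apply: corner_inj => i.
have m0 := mesh_gt0.
have := px i; have := qx i; rewrite /= !in_itv/= => /andP[q1 q2] /andP[p1 p2].
have lt1 : (corner q i)%:R * mesh < (corner p i).+1%:R * mesh.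
  by rewrite -[X in _ < X * _]natr1 mulrDl mul1r; exact: lt_trans p2.
have lt2 : (corner p i)%:R * mesh < (corner q i).+1%:R * mesh.
  by rewrite -[X in _ < X * _]natr1 mulrDl mul1r; exact: lt_trans q2.
move: lt1 lt2; rewrite !ltr_pM2r// !ltr_nat !ltnS => le1 le2.
by apply/eqP; rewrite eqn_leq le1 le2.
Qed.

Lemma grid_cell_sub (p : J) : grid_cell p `<=` unit_cube.
Proof.
move=> x px i; have := px i; rewrite /= in_itv/= => /andP[x1 x2].
have m0 := mesh_gt0.
apply/andP; split; first by apply: le_lt_trans x1; rewrite mulr_ge0// ltW.
apply: (lt_le_trans x2).
rewrite -[X in _ + X]mul1r -mulrDl natr1 ler_pdivrMr ?mul1r; last first.
  by rewrite ltr0n muln_gt0.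
rewrite ler_nat /corner; have := ltn_ord (p.2 i).
by case: (_ && _); lia.
Qed.

Lemma lebesgue_grid_cell (p : J) :
  lebesgue_rV (grid_cell p) = (mesh ^+ n.+1)%:E.
Proof. exact: lebesgue_open_box mesh_gt0. Qed.

Lemma unit_cubeE : unit_cube = open_box (fun=> 0) 1 :> set 'rV[R]_n.+1.
Proof.
by apply/seteqP; split => x b i; have := b i; rewrite /= in_itv/= add0r.
Qed.

Lemma measurable_unit_cube : measurable (unit_cube : set 'rV[R]_n.+1).
Proof. by rewrite unit_cubeE; exact: measurable_open_box. Qed.

Lemma lebesgue_unit_cube : lebesgue_rV (unit_cube : set 'rV[R]_n.+1) = 1%E.
Proof. by rewrite unit_cubeE lebesgue_open_box// expr1n. Qed.

End grid.

(** * Bumped uniform distributions *)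

Section perturbed_uniform.
Context {R : realType}.
Variables n M : nat.
Hypothesis M0 : (0 < M)%N.

Local Notation V := ('rV[R]_n.+1).
Local Notation I := {ffun 'I_n.+1 -> 'I_M}.
Local Notation J := (bool * I)%type.
Local Notation h := (mesh M : R).
Local Notation cell := (@grid_cell R n M).
Local Notation cube := (unit_cube : set V).

Variable U : probability V R.
Hypothesis UE : forall A, measurable A ->
  U A = (\int[lebesgue_rV]_(x in A) (\1_cube x : R)%:E)%E.

Let mcell (p : J) : measurable (cell p).
Proof. exact: measurable_open_box. Qed.

Let mcube : measurable cube.
Proof. exact: measurable_unit_cube. Qed.

Lemma uniform_grid_cell (p : J) : U (cell p) = (h ^+ n.+1)%:E.
Proof.
rewrite UE// integral_indic// setIidr; last exact: grid_cell_sub.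
exact: lebesgue_grid_cell.
Qed.

Let disj := @grid_cell_disj R n M M0.

Section density.
Variables (a : J -> R) (P : probability V R).
Hypotheses (a1 : forall p, -1 <= a p)
  (PE : forall A, measurable A -> P A = (\int[U]_(x in A) (step cell a x)%:E)%E).

Lemma is_density_step : is_density P (fun x => \1_cube x * step cell a x).
Proof.
have mI : measurable_fun setT (\1_cube : V -> R) by exact: measurable_indic.
have ms := measurable_step mcell a.
have s0 x : 0 <= step cell a x by exact: step_ge0 disj _ _ a1.
split; first exact: measurable_funM.
  by move=> x; rewrite mulr_ge0.
exact: (density_chain mI _ ms s0 UE PE).
Qed.

Lemma step_dominated : P `<< lebesgue_rV.
Proof.
have [mp p0 pE] := is_density_step.
apply/null_content_dominatesP => A mA A0; rewrite pE//.
by apply: null_set_integral => //; apply: measurable_funTS; exact/measurable_EFinP.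
Qed.

Lemma step_unit_cube : P cube = 1%E.
Proof.
have [mp p0 pE] := is_density_step.
rewrite -(probability_setT P) !pE// integral_mkcond; apply: eq_integral => x _.
by rewrite patchE indicE; case: ifPn => [->|_]; rewrite ?mul0r.
Qed.

End density.

(** The relation between [a] and [b] keeps the mixture of the two densities
    equal to [1], which lies in [[1 / B, B]]. *)
Lemma in_Pinfty_step (B : R) (n1 n2 : nat) (a b : J -> R)
    (P Q : probability V R) : 1 <= B -> (0 < n1 + n2)%N ->
  (forall p, -1 <= a p) -> (forall p, -1 <= b p) ->
  (forall A, measurable A -> P A = (\int[U]_(x in A) (step cell a x)%:E)%E) ->
  (forall A, measurable A -> Q A = (\int[U]_(x in A) (step cell b x)%:E)%E) ->
  (forall p, `|a p - b p| <= 1) ->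
  (forall p, n1%:R * a p + n2%:R * b p = 0) ->
  in_Pinfty B n1 n2 P Q.
Proof.
move=> B1 n0 a1 b1 PE QE ab1 ab0; split.
- by split; [exact: (step_unit_cube a1 PE)|exact: (step_unit_cube b1 QE)].
- by split; [exact: (step_dominated a1 PE)|exact: (step_dominated b1 QE)].
exists (fun x => \1_cube x * step cell a x), (fun x => \1_cube x * step cell b x).
split; [exact: (is_density_step a1 PE)|exact: (is_density_step b1 QE)|].
move=> x cx; rewrite indicE mem_set// !mul1r.
have nn : (n1 + n2)%:R != 0 :> R by rewrite pnatr_eq0 -lt0n.
rewrite (_ : _ + _ = 1); last first.
  case: (@stepP _ _ R _ _ disj x) => [[p _ E]|E]; rewrite !E.
    rewrite [LHS](_ : _ = ((n1%:R + n2%:R) + (n1%:R * a p + n2%:R * b p)) /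
      (n1 + n2)%:R); last by ring.
    by rewrite ab0 addr0 -natrD divff.
  by rewrite !mulr1 -mulrDl -natrD divff.
rewrite /= B1 andbT invf_le1 ?(lt_le_trans _ B1)//; split => //.
apply: le_trans B1; case: (@stepP _ _ R _ _ disj x) => [[p _ E]|E]; rewrite !E.
  by rewrite opprD addrACA subrr add0r.
by rewrite subrr normr0.
Qed.

(** The coefficients of [c * (1_A - 1_A')], where [A] is the cell with index
    [k] and [A'] its translate. *)
Definition bump (c : R) (k : I) (p : J) : R :=
  (p.2 == k)%:R * (if p.1 then - c else c).

Lemma sum_at (k : I) (G : J -> R) :
  \sum_p (p.2 == k)%:R * G p = G (true, k) + G (false, k).
Proof.
transitivity (\sum_(b : bool) \sum_(f : I) (f == k)%:R * G (b, f)).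
  by rewrite pair_bigA; apply: eq_bigr => -[].
rewrite big_bool/=.
by congr (_ + _); rewrite (bigD1 k)//= eqxx mul1r big1 ?addr0// => f /negbTE ->;
  rewrite mul0r.
Qed.

Lemma integral_bump (c : R) (k : I) :
  (\int[U]_x (step cell (bump c k) x)%:E = 1%:E)%E.
Proof.
rewrite (integral_step mcell uniform_grid_cell) sum_at/=.
by rewrite addNr mulr0 addr0.
Qed.

(** Bumps have mean zero, so only the product of the two perturbations
    contributes, and it vanishes unless they sit on the same two cells. *)
Lemma integral_bumpM (c : R) (k l : I) :
  (\int[U]_x (step cell (bump c k) x * step cell (bump c l) x)%:E =
   (1 + (k == l)%:R * (2 * h ^+ n.+1 * c ^+ 2))%:E)%E.
Proof.
under eq_integral do rewrite stepM//.
rewrite (integral_step mcell uniform_grid_cell) !big_split/= !sum_at/=.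
rewrite (eq_bigr _ (fun p _ => esym (mulrA _ _ _))).
by rewrite sum_at/= /bump/=; congr (_%:E); ring.
Qed.

End perturbed_uniform.

(** * Separation and indistinguishability *)

Section lower_bound.
Context {R : realType}.
Variables n M : nat.
Hypothesis M0 : (0 < M)%N.

Local Notation V := ('rV[R]_n.+1).
Local Notation I := {ffun 'I_n.+1 -> 'I_M}.
Local Notation J := (bool * I)%type.
Local Notation h := (mesh M : R).
Local Notation cell := (@grid_cell R n M).
Local Notation cube := (unit_cube : set V).

Let mcell (p : J) : measurable (cell p).
Proof. exact: measurable_open_box. Qed.

Let h0 : 0 < h := mesh_gt0 M0.

Lemma uniform_exists : exists U : probability V R, forall A, measurable A ->
  U A = (\int[lebesgue_rV]_(x in A) (\1_cube x : R)%:E)%E.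
Proof.
have mc : measurable cube by exact: measurable_unit_cube.
apply: probability_of_density => //.
by rewrite integral_indic// setIT; have := @lebesgue_unit_cube R n.
Qed.

Variable U : probability V R.
Hypothesis UE : forall A, measurable A ->
  U A = (\int[lebesgue_rV]_(x in A) (\1_cube x : R)%:E)%E.

(** The indicator of the cell [p], divided by the bound [TV_open_box] on its
    total variation, is a test function; it integrates [p - q = 1] over a
    volume [h ^ n.+1]. *)
Lemma d_BV_step (a b : J -> R) (P Q : probability V R) (p : J) :
  (forall A, measurable A -> P A = (\int[U]_(x in A) (step cell a x)%:E)%E) ->
  (forall A, measurable A -> Q A = (\int[U]_(x in A) (step cell b x)%:E)%E) ->
  a p - b p = 1 -> ((h / (2 * n.+1%:R))%:E <= d_BV P Q)%E.
Proof.
move=> PE QE ab1.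
pose c : R := (n.+1%:R * (2 * h ^+ n))^-1.
have hn : 0 < h ^+ n by rewrite exprn_gt0.
have d0 : 0 < n.+1%:R * (2 * h ^+ n) :> R by rewrite !mulr_gt0.
have c0 : 0 <= c by rewrite invr_ge0 ltW.
have Ucell := uniform_grid_cell M0 UE.
have disj := @grid_cell_disj R n M M0.
have EP (a' : J -> R) (P' : probability V R) :
    (forall A, measurable A -> P' A = (\int[U]_(x in A) (step cell a' x)%:E)%E) ->
    ('E_P'[fun x => (c * \1_(cell p) x)%R] = (c * ((1 + a' p) * h ^+ n.+1))%:E)%E.
  move=> P'E; rewrite unlock.
  under eq_integral do rewrite EFinM.
  rewrite ge0_integralZl_EFin//; last first.
    exact/measurable_EFinP/measurable_indic.
  rewrite integral_indic// setIT EFinM; congr (_ * _)%E.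
  rewrite -(integral_step_cell mcell disj Ucell a' p).
  exact: P'E.
apply: ereal_sup_ubound; exists (fun x => c * \1_(cell p) x).
  split.
    apply/integrableP; split.
      by apply/measurable_EFinP; apply: measurable_funM.
    under eq_integral do rewrite /= normrM !ger0_norm// EFinM.
    rewrite ge0_integralZl_EFin//; last first.
      exact/measurable_EFinP/measurable_indic.
    rewrite integral_indic// setIT.
    by have := @lebesgue_grid_cell R n M M0 p; rewrite /= => ->; rewrite -EFinM ltry.
  apply: (le_trans (TV_open_box _ c0 h0)).
  by rewrite lee_fin mulVf// gt_eqF.
rewrite (EP _ _ PE) (EP _ _ QE) -EFinB; congr (_%:E).
rewrite -mulrBr -mulrBl (_ : 1 + a p - (1 + b p) = 1); last first.
  by rewrite -ab1; ring.
rewrite mul1r /c exprS; field.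
by rewrite !gt_eqF// ltr0n.
Qed.

(** [second_moment_method] applied to the bumps of height [c1 = n2 / N] for
    [P] and [c2 = - n1 / N] for [Q], where [N = n1 + n2]. The exponent in the
    hypothesis comes from [n1 * c1 ^ 2 + n2 * c2 ^ 2 = n1 * n2 / N]. *)
Lemma hard_instance (n1 n2 : nat) (B alpha e : R)
    (phi : n1.-tuple V * n2.-tuple V -> bool) :
  1 <= B -> (0 < n1 + n2)%N -> 0 < e ->
  expR (2 * h ^+ n.+1 * (n1%:R * n2%:R / (n1 + n2)%:R)) <
    1 + M%:R ^+ n.+1 * e ^+ 2 ->
  level_test B alpha phi ->
  exists P Q : probability V R, [/\ in_Pinfty B n1 n2 P Q,
    ((h / (2 * n.+1%:R))%:E <= d_BV P Q)%E &
    (expect_test P Q phi <= (alpha + e)%:E)%E].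
Proof.
move=> B1 n0 e0 chi2 [mphi lvl].
have Ucell := uniform_grid_cell M0 UE.
have disj := @grid_cell_disj R n M M0.
set N : R := (n1 + n2)%:R in chi2.
have N0 : 0 < N by rewrite ltr0n.
have NE : N = n1%:R + n2%:R by rewrite /N natrD.
pose c1 : R := n2%:R / N; pose c2 : R := - (n1%:R / N).
have c1_itv : 0 <= c1 <= 1.
  by rewrite /c1 divr_ge0 ?(ltW N0)//= ler_pdivrMr// mul1r NE lerDr.
have c2_itv : -1 <= c2 <= 0.
  by rewrite /c2 lerN2 oppr_le0 divr_ge0 ?(ltW N0)// ler_pdivrMr// mul1r NE lerDl ler0n.
have c12 : c1 - c2 = 1 by rewrite opprK -mulrDl addrC -NE divff// gt_eqF.
have bump_ge (k : I) (c : R) (p : J) : `|c| <= 1 -> -1 <= bump c k p.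
  rewrite ler_norml => /andP[? ?].
  by rewrite /bump; case: (p.2 == k); case: p.1; rewrite ?mul1r ?mul0r; lra.
have a1 (k : I) (p : J) : -1 <= bump c1 k p.
  by apply: bump_ge; case/andP: c1_itv => *; rewrite ler_norml; lra.
have b1 (k : I) (p : J) : -1 <= bump c2 k p.
  by apply: bump_ge; case/andP: c2_itv => *; rewrite ler_norml; lra.
have bump_prob k c : (forall p, -1 <= bump c k p) -> exists P : probability V R,
    forall A, measurable A ->
      P A = (\int[U]_(x in A) (step cell (bump c k) x)%:E)%E.
  move=> c1'; apply: probability_of_density.
  - exact: measurable_step.
  - by move=> x; apply: step_ge0 disj _ _ c1'.
  - exact: integral_bump.
have /choice[P PE] k := bump_prob k c1 (a1 k).
have /choice[Q QE] k := bump_prob k c2 (b1 k).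
have UPinfty : in_Pinfty B n1 n2 U U.
  have U0 A : measurable A -> U A = (\int[U]_(x in A)
      (step cell (fun=> 0) x)%:E)%E.
    move=> mA; rewrite (eq_integral (fun=> 1%:E)) ?integral_cst ?mul1e//.
    by move=> x _; rewrite /step big1 ?addr0// => p _; rewrite mul0r.
  apply: (in_Pinfty_step M0 UE B1 n0 _ _ U0 U0) => //.
  - by move=> p; rewrite subrr normr0.
  - by move=> p; rewrite !mulr0 addr0.
have U_level : (\int[power_measure U n1 \x power_measure U n2]_z
    ((phi z)%:R : R)%:E <= alpha%:E)%E.
  by have := lvl U UPinfty; rewrite /expect_test unlock.
have [k Pk] : exists k, (\int[power_measure (P k) n1 \x power_measure (Q k) n2]_z
    ((phi z)%:R : R)%:E <= (alpha + e)%:E)%E.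
  apply: (@second_moment_method _ _ _ n1 n2 U I P Q
    (fun k => step cell (bump c1 k)) (fun k => step cell (bump c2 k))
    (2 * h ^+ n.+1 * c1 ^+ 2) (2 * h ^+ n.+1 * c2 ^+ 2)) => //.
  - by rewrite card_ffun !card_ord expn_gt0 M0.
  - by move=> k; exact: measurable_step.
  - by move=> k; exact: measurable_step.
  - by move=> k x; apply: step_ge0 disj _ _ (a1 k).
  - by move=> k x; apply: step_ge0 disj _ _ (b1 k).
  - by move=> k l; exact: integral_bumpM.
  - by move=> k l; exact: integral_bumpM.
  rewrite card_ffun !card_ord natrX; apply: le_lt_trans chi2.
  have expB (s : R) m : 0 <= s -> (1 + s) ^+ m <= expR (m%:R * s).
    move=> s0; rewrite expRM_natl lerXn2r ?nnegrE ?addr_ge0 ?expR_ge0//.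
    exact: expR_ge1Dx.
  have v0 : 0 <= 2 * h ^+ n.+1 by rewrite mulr_ge0// exprn_ge0// ltW.
  apply: (@le_trans _ _ (expR (n1%:R * (2 * h ^+ n.+1 * c1 ^+ 2)) *
      expR (n2%:R * (2 * h ^+ n.+1 * c2 ^+ 2)))).
    by apply: ler_pM; rewrite ?exprn_ge0 ?expB// ?addr_ge0// mulr_ge0// sqr_ge0.
  rewrite -expRD ler_expR le_eqVlt; apply/orP; left; apply/eqP.
  rewrite /c1 /c2 NE; field; rewrite -NE gt_eqF//.
exists (P k), (Q k); split.
- apply: (in_Pinfty_step M0 UE B1 n0 (a1 k) (b1 k) (PE k) (QE k)) => p.
  + rewrite /bump -mulrBr; case: (p.2 == k); last by rewrite mul0r normr0.
    by rewrite mul1r; case: p.1; rewrite -?opprD ?normrN c12 normr1.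
  + rewrite /bump; suff E : n1%:R * c1 + n2%:R * c2 = 0.
      case: (p.2 == k); case: p.1; rewrite ?mul0r ?mulr0 ?addr0// !mul1r//.
      by transitivity (- (n1%:R * c1 + n2%:R * c2)); [ring|rewrite E oppr0].
    by rewrite /c1 /c2; ring.
- have ab1 : bump c1 k (false, k) - bump c2 k (false, k) = 1.
    by rewrite /bump/= eqxx !mul1r.
  exact: (d_BV_step (PE k) (QE k) ab1).
- by rewrite /expect_test unlock.
Qed.

End lower_bound.

(** Calibration of the grid, with [x] in the role of the smaller sample size
    and [t ^ d = x / ln x]: the number [M] of cells per axis is the least
    integer above [4 * t]. From above, [M <= 5 * t] keeps the mesh at least
    [1 / (10 * t)]. From below, [2 * M >= 8 * t] makes the exponent at most
    [ln x / 4], so that the exponential is at most the fourth root [r] of [x],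
    while [M ^ d >= x / ln x] exceeds [r ^ 2 / 2] because
    [ln (r ^ 2) < r ^ 2]; and [r <= r ^ 2 / 2 * e ^ 2] as [2 / e ^ 2 < r]. *)
Lemma grid_size {R : realType} (d : nat) (x e : R) :
  (0 < d)%N -> 2 <= x -> 0 < e -> (2 / e ^+ 2) ^+ 4 < x ->
  exists M : nat, [/\ (0 < M)%N,
    (20 * d%:R)^-1 * (ln x / x) `^ d%:R^-1 <= mesh M / (2 * d%:R) &
    forall y, y <= x -> expR (2 * mesh M ^+ d * y) < 1 + M%:R ^+ d * e ^+ 2].
Proof.
move=> d0 x2 e0 ex.
have x0 : 0 < x by rewrite (lt_le_trans _ x2).
have L0 : 0 < ln x by rewrite ln_gt0// (lt_le_trans _ x2)// ltr1n.
set L := ln x in L0 *.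
have xE : expR L = x by rewrite lnK.
have Lx : L <= x by rewrite -xE (le_trans _ (expR_ge1Dx _))// lerDr.
have dR : 0 < d%:R :> R by rewrite ltr0n.
pose t := (x / L) `^ d%:R^-1.
have xL0 : 0 < x / L by rewrite divr_gt0.
have td : t ^+ d = x / L.
  by rewrite -powR_mulrn ?powR_ge0// -powRrM mulVf ?gt_eqF// powRr1// ltW.
have t1 : 1 <= t.
  apply: (@le_trans _ _ (1 `^ d%:R^-1)); first by rewrite powR1.
  rewrite ge0_ler_powR ?nnegrE ?invr_ge0 ?ler0n ?ler01 ?(ltW xL0)//.
  by rewrite ler_pdivlMr// mul1r.
have t0 : 0 < t by rewrite (lt_le_trans _ t1).
have tV : (L / x) `^ d%:R^-1 = t^-1.
  have tn : t != 0 by rewrite gt_eqF.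
  apply: (mulIf tn); rewrite mulVf// -powRM ?divr_ge0 ?ltW//.
  by rewrite -(invf_div x L) mulVf ?gt_eqF// powR1.
pose M := (Num.truncn (4 * t)).+1.
have /andP[M1 M2] : (4 * t) < M%:R <= 4 * t + 1.
  have /andP[h1 h2] := @truncn_itv R (4 * t) (mulr_ge0 (ler0n _ 4) (ltW t0)).
  by rewrite /M h2/= -natr1 lerD2r.
have MR : 0 < M%:R :> R by rewrite ltr0n.
have Md : x / L <= M%:R ^+ d.
  by rewrite -td lerXn2r ?nnegrE ?ltW//; lra.
exists M; split => //.
  rewrite tV /mesh natrM -!invfM lef_pV2 ?posrE ?mulr_gt0//.
  have : M%:R <= 5 * t by lra.
  by move=> M5; rewrite -mulrA [leRHS](_ : _ = 4 * (d%:R * (5 * t))); [|ring]; nra.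
move=> y yx.
pose r := expR (L / 4).
have r4 : r ^+ 4 = x by rewrite -expRM_natl -xE; congr expR; field.
have r0 : 0 < r by rewrite expR_gt0.
have r2 : L / 2 < r ^+ 2.
  rewrite -expRM_natl (_ : 2 * (L / 4) = L / 2); last by field.
  by rewrite (lt_le_trans _ (expR_ge1Dx _))// ltrDr.
have er : 2 / e ^+ 2 < r.
  have e2 : 0 <= 2 / e ^+ 2 by rewrite divr_ge0// sqr_ge0.
  by rewrite -(@ltr_pXn2r _ 4)// ?nnegrE ?(ltW r0)// r4.
have h8 : 2 * mesh M ^+ d * x <= L / 4.
  (* The exponent [d] is positive, so [8 ^ d] is at least [8]. *)
  have : 8 * (x / L) <= (2 * M)%:R ^+ d :> R.
    apply: (@le_trans _ _ ((8 * t) ^+ d)).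
      rewrite exprMn td ler_pM2r//; rewrite -[leLHS]expr1 ler_eXn2l ?ltr1n//.
    by rewrite lerXn2r ?nnegrE ?mulr_ge0 ?ler0n ?(ltW t0)// natrM; lra.
  have D0 : 0 < (2 * M)%:R ^+ d :> R by rewrite exprn_gt0// ltr0n.
  rewrite mulrA ler_pdivrMr// => h.
  rewrite /mesh exprVn mulrAC ler_pdivrMr//; lra.
apply: (@le_lt_trans _ _ r).
  rewrite ler_expR (le_trans _ h8)// ler_wpM2l// mulr_ge0// exprn_ge0//.
  by rewrite invr_ge0.
apply: (@le_lt_trans _ _ (M%:R ^+ d * e ^+ 2)); last by rewrite ltrDr.
have e20 : 0 < e ^+ 2 by rewrite exprn_gt0.
apply: (@le_trans _ _ (r ^+ 2 / 2 * e ^+ 2)).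
  move: er; rewrite ltr_pdivrMr// => er; nra.
rewrite ler_pM2r// (le_trans _ Md)//.
rewrite ler_pdivlMr// -r4; nra.
Qed.

Theorem theorem2 (R : realType) (d : nat) (B : R)
    (hd : (2 <= d)%N) (hB : 2 <= B) :
  exists c : R, 0 < c /\
    forall alpha beta : R, 0 < alpha < 1 -> 0 < beta < 1 - alpha ->
    exists N : nat,
      forall n1 n2 : nat, (N <= minn n1 n2)%N ->
      forall phi : n1.-tuple 'rV[R]_d * n2.-tuple 'rV[R]_d -> bool,
        level_test B alpha phi ->
        exists P Q : probability 'rV[R]_d R,
          [/\ in_Pinfty B n1 n2 P Q,
              ((c * (ln (minn n1 n2)%:R / (minn n1 n2)%:R) `^ d%:R^-1)%:E
                 <= d_BV P Q)%E &
              (expect_test P Q phi <= (1 - beta)%:E)%E].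
Proof.
case: d hd => // n _.
have d0 : 0 < n.+1%:R :> R by rewrite ltr0n.
exists (20 * n.+1%:R)^-1; split; first by rewrite invr_gt0 mulr_gt0.
move=> alpha beta _ /andP[_ beta1].
pose e := 1 - beta - alpha.
have e0 : 0 < e by rewrite /e; lra.
exists (maxn 2 (Num.truncn ((2 / e ^+ 2) ^+ 4)).+1) => n1 n2.
set m := minn n1 n2; rewrite geq_max => /andP[m2 mN] phi lvl.
have mx : (2 / e ^+ 2) ^+ 4 < m%:R.
  by apply: lt_le_trans (truncnS_gt _) _; rewrite ler_nat.
have m2R : 2 <= m%:R :> R by rewrite ler_nat.
have [M [M0 meshM chi2]] := grid_size (ltn0Sn n) m2R e0 mx.
have [U UE] := @uniform_exists R n.
have n0 : (0 < n1 + n2)%N by move: m2; rewrite /m; lia.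
have B1 : 1 <= B by lra.
have chi := chi2 (n1%:R * n2%:R / (n1 + n2)%:R).
have [|P [Q [PQ dPQ tPQ]]] := hard_instance M0 UE B1 n0 e0 (chi _) lvl.
  rewrite ler_pdivrMr ?ltr0n// -!natrM ler_nat /m; nia.
exists P, Q; split => //.
  by apply: le_trans dPQ; rewrite lee_fin.
by rewrite (_ : 1 - beta = alpha + e)// /e; ring.
Qed.
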